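(* Let $V$ and $H$ be complex Hilbert spaces such that $V$ is continuously embedded in $H$. Let $\mathfrak{a}:V\times V\to\mathbb{C}$ be a closed, sectorial, sesquilinear form. Let $A$ be the $m$-sectorial graph in $H$ associated with $\mathfrak{a}$. Let $(V_n)_{n\in\mathbb{N}}$ be an increasing sequence of closed subspaces of $V$ such that $\bigcup_{n\in\mathbb{N}}V_n$ is dense in $V$. For all $n\in\mathbb{N}$ let $\mathfrak{a}_n=\mathfrak{a}|_{V_n\times V_n}$ and let $A_n$ be the $m$-sectorial graph in $H$ associated with $\mathfrak{a}_n$. Let $S^{(n)}$ and $S$ be the (degenerate) semigroups generated by $-A_n$ and $-A$, respectively. Then $$\lim_{n\to\infty}\sup_{t\in(0,T]}\|(S^{(n)}_t-S_t)f\|_H=0$$ for every $T>0$ and every $f\in H$.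
   Context: For $\theta\in(0,\frac{\pi}{2}]$ let $\Sigma_\theta=\{z\in\mathbb{C}\setminus\{0\}:|\arg z|<\theta\}$. A form on $H$ is a sesquilinear map $\mathfrak{a}:V\times V\to\mathbb{C}$ whose form domain $V$ is a linear subspace of $H$ (not necessarily dense); write $\mathfrak{a}(u)=\mathfrak{a}(u,u)$ and $(\Re\mathfrak{a})(u,v)=\frac12(\mathfrak{a}(u,v)+\overline{\mathfrak{a}(v,u)})$. The form is sectorial if there are $\theta\in(0,\frac{\pi}{2})$ and $\gamma\in\mathbb{R}$ such that $\mathfrak{a}(u)-\gamma\|u\|_H^2\in\overline{\Sigma_\theta}$ for all $u\in V$. A sectorial form is closed if there is $\omega\in\mathbb{R}$ such that $(u,v)\mapsto(\Re\mathfrak{a})(u,v)+\omega(u,v)_H$ is a complete inner product on $V$. The graph associated with a closed sectorial form $\mathfrak{a}$ is $A=\{(u,f)\in H\times H:u\in V\text{ and }\mathfrak{a}(u,v)=(f,v)_H\text{ for all }v\in V\}$. A graph on $H$ is a linear subspace $A\subseteq H\times H$; $\lambda I+A:=\{(u,\lambda u+f):(u,f)\in A\}$, and it is boundedly invertible if its inverse relation is the graph of a bounded everywhere defined operator, denoted $(\lambda I+A)^{-1}$. A degenerate semigroup on $H$ is a function $S:(0,\infty)\to\mathcal{L}(H)$ which is strongly continuous on $(0,\infty)$, satisfies $S_{t+s}=S_tS_s$ for all $s,t>0$, and satisfies $\sup_{t\in(0,1)}\|S_t\|<\infty$. For a graph $A$, $-A$ is the generator of $S$ if there is $\omega\in\mathbb{R}$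 such that $\lambda I+A$ is boundedly invertible for every $\lambda>\omega$ and $(\lambda I+A)^{-1}x=\int_0^\infty e^{-\lambda t}S_tx\,dt$ for all $x\in H$ and $\lambda>\omega$. If $A$ is associated with a closed sectorial form, then $-A$ generates a (unique) degenerate semigroup.
   Formalization: Closedness here also requires that the norm of the complete inner product Re a + ω(·,·)_H control the H-norm; this is automatic for ω > −γ, and without it Hamel-basis pathological forms satisfy the stated definition but violate the claim. *)

(* Defs.v *)
From Stdlib Require Import Reals.
From Coquelicot Require Import Coquelicot.

Open Scope R_scope.

(* * Hilbert spaces *)

(* Sesquilinear maps are linear in the first argument. *)
Record sesquilinear {E : ModuleSpace C_AbsRing} (b : E -> E -> C) : Prop := {
  sesqui_plus_l : forall u v w, b (plus u v) w = Cplus (b u w) (b v w);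
  sesqui_scal_l : forall (c : C) u w, b (scal c u) w = Cmult c (b u w);
  sesqui_plus_r : forall u v w, b u (plus v w) = Cplus (b u v) (b u w);
  sesqui_scal_r : forall (c : C) u w,
    b u (scal c w) = Cmult (Cconj c) (b u w) }.

Record is_inner_product {E : ModuleSpace C_AbsRing} (ip : E -> E -> C)
  : Prop := {
  ip_sesqui : sesquilinear ip;
  ip_herm : forall u v, ip v u = Cconj (ip u v);
  ip_pos : forall u, 0 <= fst (ip u u);
  ip_def : forall u, fst (ip u u) = 0 -> u = zero }.

Definition ip_norm {E : ModuleSpace C_AbsRing} (ip : E -> E -> C) (u : E) : R :=
  sqrt (fst (ip u u)).

Definition ip_complete {E : ModuleSpace C_AbsRing} (ip : E -> E -> C) : Prop :=
  forall u : nat -> E,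
    (forall eps : posreal, exists N : nat, forall n m : nat,
       (N <= n)%nat -> (N <= m)%nat -> ip_norm ip (minus (u n) (u m)) < eps) ->
    exists l : E, is_lim_seq (fun n => ip_norm ip (minus (u n) l)) 0.

Structure Hilbert := {
  hilbert_space :> CompleteNormedModule C_AbsRing;
  inner : hilbert_space -> hilbert_space -> C;
  inner_is_ip : is_inner_product inner;
  norm_inner : forall u : hilbert_space, norm u = ip_norm inner u }.

Arguments inner {_} _ _.

(* Restriction of scalars from C to R: needed because Coquelicot's
   vector-valued Riemann integral only exists in real normed modules. *)
Section RestrictScalars.

Variable E : NormedModule C_AbsRing.

Lemma real_scal_assoc (x y : R) (u : E) :
  scal (RtoC x) (scal (RtoC y) u) = scal (RtoC (mult x y)) u.
Proof.
  rewrite scal_assoc. f_equal. symmetry. exact (RtoC_mult x y).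
Qed.

Lemma real_scal_one (u : E) : scal (RtoC one) u = u.
Proof. exact (scal_one u). Qed.

Lemma real_scal_distr_l (x : R) (u v : E) :
  scal (RtoC x) (plus u v) = plus (scal (RtoC x) u) (scal (RtoC x) v).
Proof. exact (scal_distr_l (RtoC x) u v). Qed.

Lemma real_scal_distr_r (x y : R) (u : E) :
  scal (RtoC (plus x y)) u = plus (scal (RtoC x) u) (scal (RtoC y) u).
Proof.
  rewrite <- (scal_distr_r (RtoC x) (RtoC y) u). f_equal. exact (RtoC_plus x y).
Qed.

Definition real_ModuleSpace_mixin :=
  ModuleSpace.Mixin R_AbsRing E (fun (x : R) (u : E) => scal (RtoC x) u)
    real_scal_assoc real_scal_one real_scal_distr_l real_scal_distr_r.

Definition real_NormedModuleAux : NormedModuleAux R_AbsRing :=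
  NormedModuleAux.Pack R_AbsRing E
    (NormedModuleAux.Class R_AbsRing E
      (ModuleSpace.Class R_AbsRing E
        (AbelianGroup.class (NormedModule.AbelianGroup C_AbsRing E))
        real_ModuleSpace_mixin)
      (UniformSpace.class (NormedModule.UniformSpace C_AbsRing E))) E.

Lemma real_norm_scal (l : R) (u : E) :
  norm (scal (RtoC l) u) <= abs l * norm u.
Proof.
  eapply Rle_trans; [exact (norm_scal (RtoC l) u)|].
  apply Req_le. f_equal. exact (Cmod_R l).
Qed.

Definition real_NormedModule_mixin :=
  NormedModule.Mixin R_AbsRing real_NormedModuleAux
    (fun u : E => norm u) (@norm_factor C_AbsRing E)
    (fun u v : E => norm_triangle u v) real_norm_scal
    (fun (u v : E) eps h => norm_compat1 u v eps h)
    (fun (u v : E) eps h => norm_compat2 u v eps h)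
    (fun (u : E) h => norm_eq_zero u h).

Definition real_NormedModule : NormedModule R_AbsRing :=
  NormedModule.Pack R_AbsRing E
    (NormedModule.Class R_AbsRing E
      (NormedModuleAux.class R_AbsRing real_NormedModuleAux)
      real_NormedModule_mixin) E.

End RestrictScalars.

(* * Subspaces and closures *)

Definition adherent {T : UniformSpace} (D : T -> Prop) (x : T) : Prop :=
  forall P : T -> Prop, locally x P -> exists y, P y /\ D y.

Definition dense {T : UniformSpace} (D : T -> Prop) : Prop :=
  forall x, adherent D x.

Record linear_subspace {E : ModuleSpace C_AbsRing} (D : E -> Prop) : Prop := {
  subspace_zero : D zero;
  subspace_plus : forall u v, D u -> D v -> D (plus u v);
  subspace_scal : forall (c : C) u, D u -> D (scal c u) }.

(* [Rabs phi < theta <= PI / 2] makes [phi] the principal argument of [z]. *)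
Definition sector (theta : R) (z : C) : Prop :=
  exists r phi : R, 0 < r /\ Rabs phi < theta /\ z = (r * cos phi, r * sin phi).

(* * Forms

   The form domain is a Hilbert space [V] identified with a subspace of [H]
   through a continuous linear injection [j : V -> H]. *)

Definition sectorial_form {V H : Hilbert} (j : V -> H) (a : V -> V -> C) : Prop :=
  exists theta gamma : R, 0 < theta < PI / 2 /\
    forall u : V,
      adherent (sector theta) (Cminus (a u u) (RtoC (gamma * norm (j u) ^ 2))).

Definition real_form {V : Hilbert} (a : V -> V -> C) (u v : V) : C :=
  Cmult (RtoC (1 / 2)) (Cplus (a u v) (Cconj (a v u))).

Definition form_inner {V H : Hilbert} (j : V -> H) (a : V -> V -> C) (omega : R)
  (u v : V) : C :=
  Cplus (real_form a u v) (Cmult (RtoC omega) (inner (j u) (j v))).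

(* As usual for closed forms, the norm given by [form_inner j a omega] has to
   be a form norm, i.e. to control the norm of [H]; for a sectorial form with
   vertex [gamma] this is automatic whenever [omega > - gamma].  It must be
   required: for small [omega] the inner product can be complete for an
   algebraic (Hamel basis) reason although the form is not closed.  Since the
   norm of [V] also controls that of [H], the closed graph theorem then makes
   it equivalent to the form norm. *)
Definition closed_form {V H : Hilbert} (j : V -> H) (a : V -> V -> C) : Prop :=
  exists omega : R,
    is_inner_product (form_inner j a omega) /\
    ip_complete (form_inner j a omega) /\
    exists M : R, forall u : V, norm (j u) <= M * ip_norm (form_inner j a omega) u.

(* * Graphs, i.e. linear relations in [H] *)

(* Graph associated with the restriction of the form [a] to [D * D]. *)
Definition form_graph {V H : Hilbert} (j : V -> H) (a : V -> V -> C)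
  (D : V -> Prop) (x f : H) : Prop :=
  exists u : V, D u /\ x = j u /\ forall v : V, D v -> a u v = inner f (j v).

Definition shift_graph {H : Hilbert} (lambda : R) (A : H -> H -> Prop)
  (u g : H) : Prop :=
  exists f : H, A u f /\ g = plus (scal (RtoC lambda) u) f.

(* [B] is boundedly invertible and its inverse is the operator [Q]. *)
Definition bounded_inverse {H : Hilbert} (B : H -> H -> Prop) (Q : H -> H) : Prop :=
  is_linear Q /\ forall u g : H, B u g <-> u = Q g.

(* * Degenerate semigroups; the values [S t] for [t <= 0] are irrelevant. *)

Record degenerate_semigroup {H : Hilbert} (S : R -> H -> H) : Prop := {
  semigroup_bounded_op : forall t, 0 < t -> is_linear (S t);
  semigroup_continuous : forall (x : H) (t : R),
    0 < t -> continuous (fun s => S s x) t;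
  semigroup_law : forall (s t : R) (x : H),
    0 < s -> 0 < t -> S (t + s) x = S t (S s x);
  semigroup_bounded_near_0 : exists M : R, forall (t : R) (x : H),
    0 < t < 1 -> norm (S t x) <= M * norm x }.

(* [- A] is the generator of [S]; the Laplace transform is an improper
   Riemann integral over the open half-line. *)
Definition neg_generator {H : Hilbert} (A : H -> H -> Prop) (S : R -> H -> H)
  : Prop :=
  exists omega : R, forall lambda : R, omega < lambda ->
    exists Q : H -> H,
      bounded_inverse (shift_graph lambda A) Q /\
      forall x : H,
        @is_RInt_gen (real_NormedModule H)
          (fun t : R => scal (RtoC (exp (- lambda * t))) (S t x))
          (at_right 0) (Rbar_locally p_infty) (Q x).

(* Main.v *)
Require Import Defs.
From Stdlib Require Import Reals Lra Lia ClassicalEpsilon.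
From Coquelicot Require Import Coquelicot.

(* The Laplace transform identity, tested against bounded real functionals,
   shows that [S t x] solves [u' + A u = 0] for [x] in the domain of [A].
   Since the numerical range of the form lies in a half-plane, the energy
   [norm (u t) ^ 2] then grows at most exponentially, with a rate common to all
   the [An].  An element [q] with [(0, q)] in [A] is killed by [S], hence by
   every [Sn], and modulo such elements the domain of [A] is dense.  All the
   graphs have a resolvent [Q], [Qn] at a common point [l], and [Qn -> Q]
   strongly by Cea's lemma; there the closed graph theorem is what makes the
   form norm continuous on [V].  For [k = Q m] with [m] in the domain, the defect
   [Sn t (Qn k) - Qn (S t k)] vanishes at [0] and solves the evolution equation of
   [An] with right-hand side [(Qn - Q) (S t m)], which tends to [0] uniformly
   because [t |-> S t m] is Lipschitz; the energy estimate for the defect gives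
   the uniform convergence. *)

(** Two features of degenerate semigroups shape the argument. The supremum includes arbitrarily
    small [t], yet [S t f] need not tend to [f] at [0]; convergence at [0] is obtained only for [f]
    in the domain of [A]. So [f] is split orthogonally into [p + q], with [p] in the closure of the
    domain and [(0, q)] in [A]. Injectivity of [j] then makes [q] orthogonal to the whole range of
    [j], which is why [(0, q)] lies in every [An] as well. Moreover, each generator brings its own
    half-line of admissible [lambda], without uniformity in [n]; a common [kappa] is what allows all
    resolvents to be moved to one point. The defect is differentiated through [S t k], and its
    forcing term contains [S t m]; both orbits must be regular, which forces [k = Q m] with [m] in
    the domain, and hence the density of the vectors [Q (Q m)]. Sectoriality enters twice: the lower
    bound for the real part gives [kappa], and the bound for the imaginary part makes the
    non-symmetric form continuous, as Cea's lemma requires. *)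

Open Scope R_scope.

(** * Real part of an inner product *)

Section RealInnerProduct.

Context {E : ModuleSpace C_AbsRing} (ip : E -> E -> C).
Hypothesis ip_ok : is_inner_product ip.

(** The real part is a symmetric real bilinear form that still separates points, so vector
    identities and estimates reduce to real arithmetic. *)
Definition re_ip (u v : E) : R := fst (ip u v).

Lemma re_ip_plus_l (u v w : E) : re_ip (plus u v) w = re_ip u w + re_ip v w.
Proof. unfold re_ip. rewrite (sesqui_plus_l _ (ip_sesqui _ ip_ok)). reflexivity. Qed.

Lemma re_ip_sym (u v : E) : re_ip u v = re_ip v u.
Proof. unfold re_ip. rewrite (ip_herm _ ip_ok v u). reflexivity. Qed.

Lemma re_ip_scal_l (r : R) (u w : E) : re_ip (scal (RtoC r) u) w = r * re_ip u w.
Proof.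
  unfold re_ip. rewrite (sesqui_scal_l _ (ip_sesqui _ ip_ok)).
  unfold Cmult, RtoC; simpl. ring.
Qed.

Lemma re_ip_zero_l (w : E) : re_ip zero w = 0.
Proof.
  pose proof (re_ip_plus_l zero zero w) as k. rewrite plus_zero_l in k. lra.
Qed.

Lemma re_ip_opp_l (u w : E) : re_ip (opp u) w = - re_ip u w.
Proof.
  pose proof (re_ip_plus_l u (opp u) w) as k.
  assert (e : plus u (opp u) = zero) by exact (plus_opp_r u).
  rewrite e, re_ip_zero_l in k. lra.
Qed.

Lemma re_ip_minus_l (u v w : E) : re_ip (minus u v) w = re_ip u w - re_ip v w.
Proof. unfold minus. rewrite re_ip_plus_l, re_ip_opp_l. ring. Qed.

Lemma re_ip_plus_r (u v w : E) : re_ip w (plus u v) = re_ip w u + re_ip w v.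
Proof. rewrite re_ip_sym, re_ip_plus_l, !(re_ip_sym w). reflexivity. Qed.

Lemma re_ip_scal_r (r : R) (u w : E) : re_ip w (scal (RtoC r) u) = r * re_ip w u.
Proof. rewrite re_ip_sym, re_ip_scal_l, (re_ip_sym w). reflexivity. Qed.

Lemma re_ip_opp_r (u w : E) : re_ip w (opp u) = - re_ip w u.
Proof. rewrite re_ip_sym, re_ip_opp_l, (re_ip_sym w). reflexivity. Qed.

Lemma re_ip_minus_r (u v w : E) : re_ip w (minus u v) = re_ip w u - re_ip w v.
Proof. rewrite re_ip_sym, re_ip_minus_l, !(re_ip_sym w). reflexivity. Qed.

Lemma re_ip_zero_r (w : E) : re_ip w zero = 0.
Proof. rewrite re_ip_sym. apply re_ip_zero_l. Qed.

End RealInnerProduct.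

Ltac ip_expand L :=
  repeat first
    [ rewrite (re_ip_plus_l _ L)
    | rewrite (re_ip_plus_r _ L)
    | rewrite (re_ip_scal_l _ L)
    | rewrite (re_ip_scal_r _ L)
    | rewrite (re_ip_minus_l _ L)
    | rewrite (re_ip_minus_r _ L)
    | rewrite (re_ip_opp_l _ L)
    | rewrite (re_ip_opp_r _ L)
    | rewrite (re_ip_zero_l _ L)
    | rewrite (re_ip_zero_r _ L) ].

Ltac ip_expand_in L k :=
  repeat first
    [ rewrite (re_ip_plus_l _ L) in k
    | rewrite (re_ip_plus_r _ L) in k
    | rewrite (re_ip_scal_l _ L) in k
    | rewrite (re_ip_scal_r _ L) in k
    | rewrite (re_ip_minus_l _ L) in k
    | rewrite (re_ip_minus_r _ L) in k
    | rewrite (re_ip_opp_l _ L) in k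
    | rewrite (re_ip_opp_r _ L) in k
    | rewrite (re_ip_zero_l _ L) in k
    | rewrite (re_ip_zero_r _ L) in k ].

Section InnerProductNorm.

Context {E : ModuleSpace C_AbsRing} (ip : E -> E -> C).
Hypothesis ip_ok : is_inner_product ip.

Lemma re_ip_pos (u : E) : 0 <= re_ip ip u u.
Proof. exact (ip_pos _ ip_ok u). Qed.

Lemma re_ip_def (u : E) : re_ip ip u u = 0 -> u = zero.
Proof. exact (ip_def _ ip_ok u). Qed.

Lemma re_ip_ext (u v : E) : (forall z, re_ip ip u z = re_ip ip v z) -> u = v.
Proof.
  intros h. apply plus_reg_r with (opp v).
  transitivity (zero : E); [|symmetry; exact (plus_opp_r v)].
  apply re_ip_def. change (plus u (opp v)) with (minus u v).
  ip_expand ip_ok. rewrite !h. ring.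
Qed.

Lemma ip_norm_sqr (u : E) : ip_norm ip u ^ 2 = re_ip ip u u.
Proof. unfold ip_norm. rewrite pow2_sqrt; [reflexivity | exact (re_ip_pos u)]. Qed.

Lemma ip_norm_ge0 (u : E) : 0 <= ip_norm ip u.
Proof. apply sqrt_pos. Qed.

Lemma ip_norm_eq0 (u : E) : ip_norm ip u = 0 -> u = zero.
Proof. intros h. apply re_ip_def. rewrite <- ip_norm_sqr, h. ring. Qed.

Lemma ip_norm_minus_eq0 (u v : E) : ip_norm ip (minus u v) = 0 -> u = v.
Proof.
  intros h. apply re_ip_ext. intros z.
  pose proof (re_ip_zero_l ip ip_ok z) as k. rewrite <- (ip_norm_eq0 _ h) in k.
  ip_expand_in ip_ok k. lra.
Qed.

Lemma cauchy_schwarz (u v : E) : re_ip ip u v <= ip_norm ip u * ip_norm ip v.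
Proof.
  pose proof (ip_norm_ge0 u) as hu. pose proof (ip_norm_ge0 v) as hv.
  destruct (Req_dec (ip_norm ip u) 0) as [h|h].
  { rewrite (ip_norm_eq0 _ h) at 1. rewrite (re_ip_zero_l ip ip_ok), h. lra. }
  destruct (Req_dec (ip_norm ip v) 0) as [h'|h'].
  { rewrite (ip_norm_eq0 _ h') at 1. rewrite (re_ip_zero_r ip ip_ok), h'. lra. }
  (* With lengths [|u|] and [|v|], the square of [|v| u - |u| v] is [2 |u| |v| (|u| |v| - rip u v)];
     dividing by [|u| |v|] is why the two null cases come first. *)
  pose proof (re_ip_pos (minus (scal (RtoC (ip_norm ip v)) u)
    (scal (RtoC (ip_norm ip u)) v))) as k.
  ip_expand_in ip_ok k. rewrite <- !ip_norm_sqr, (re_ip_sym ip ip_ok v u) in k.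
  assert (0 < ip_norm ip u * ip_norm ip v) by (apply Rmult_lt_0_compat; lra).
  apply Rmult_le_reg_l with (ip_norm ip u * ip_norm ip v); [assumption|].
  nra.
Qed.

Lemma ip_norm_triangle (u v : E) :
  ip_norm ip (plus u v) <= ip_norm ip u + ip_norm ip v.
Proof.
  pose proof (ip_norm_ge0 u). pose proof (ip_norm_ge0 v).
  pose proof (ip_norm_ge0 (plus u v)). pose proof (cauchy_schwarz u v).
  apply Rsqr_incr_0; [|assumption|lra].
  rewrite !Rsqr_pow2, ip_norm_sqr. ip_expand ip_ok.
  rewrite (re_ip_sym ip ip_ok v u), <- !ip_norm_sqr. nra.
Qed.

Lemma ip_norm_scal (r : R) (u : E) :
  ip_norm ip (scal (RtoC r) u) = Rabs r * ip_norm ip u.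
Proof.
  apply Rsqr_inj; [apply ip_norm_ge0 | apply Rmult_le_pos;
    [apply Rabs_pos | apply ip_norm_ge0] |].
  rewrite Rsqr_mult, <- Rsqr_abs, !Rsqr_pow2, !ip_norm_sqr. ip_expand ip_ok. ring.
Qed.

Lemma ip_norm_minus_sym (u v : E) : ip_norm ip (minus u v) = ip_norm ip (minus v u).
Proof.
  unfold ip_norm. f_equal.
  change (re_ip ip (minus u v) (minus u v) = re_ip ip (minus v u) (minus v u)).
  ip_expand ip_ok. ring.
Qed.

End InnerProductNorm.

Notation rip := (re_ip inner).
Ltac rip_expand :=
  repeat match goal with
  | |- context [re_ip (@inner ?K) _ _] => progress ip_expand (inner_is_ip K)
  end.
Ltac rip_expand_in k :=
  repeat match type of k with
  | context [re_ip (@inner ?K) _ _] => progress ip_expand_in (inner_is_ip K) k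
  end.

(* Identities between vectors are checked against all test vectors. *)
Ltac vec := apply (re_ip_ext _ (inner_is_ip _)); intro; rip_expand;
  first [ring | field].

Section HilbertSpace.

Context {H : Hilbert}.
Implicit Types x y z : H.

Lemma norm_sqr x : norm x ^ 2 = rip x x.
Proof. rewrite norm_inner. apply ip_norm_sqr, inner_is_ip. Qed.

Lemma rip_sym x y : rip x y = rip y x.
Proof. apply re_ip_sym, inner_is_ip. Qed.

Lemma norm_rscal (r : R) x : norm (scal (RtoC r) x) = Rabs r * norm x.
Proof. rewrite !norm_inner. exact (ip_norm_scal inner (inner_is_ip H) r x). Qed.

Lemma norm_rscal_m1 x : norm (scal (RtoC (-1)) x) = norm x.
Proof. rewrite norm_rscal, Rabs_left; lra. Qed.

Lemma norm_eq_rscal (r : R) x y : y = scal (RtoC r) x -> norm y = Rabs r * norm x.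
Proof. intros ->. apply norm_rscal. Qed.

Lemma norm_le_eq x y (c : R) : norm x <= c -> x = y -> norm y <= c.
Proof. intros h <-. exact h. Qed.

Lemma norm_minus_sym x y : norm (minus x y) = norm (minus y x).
Proof. rewrite !norm_inner. exact (ip_norm_minus_sym inner (inner_is_ip H) x y). Qed.

Lemma norm_minus_eq0 x y : norm (minus x y) = 0 -> x = y.
Proof. rewrite norm_inner. exact (ip_norm_minus_eq0 inner (inner_is_ip H) x y). Qed.

Lemma hnorm_ge_0 x : 0 <= norm x.
Proof. exact (norm_ge_0 x). Qed.

Lemma hnorm_triangle x y : norm (plus x y) <= norm x + norm y.
Proof. exact (norm_triangle x y). Qed.

Lemma norm_minus_triangle x y z :
  norm (minus x z) <= norm (minus x y) + norm (minus y z).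
Proof.
  replace (minus x z) with (plus (minus x y) (minus y z)) by vec.
  exact (hnorm_triangle _ _).
Qed.

Lemma norm_minus_le x y : norm (minus x y) <= norm x + norm y.
Proof.
  replace (minus x y) with (plus x (scal (RtoC (-1)) y)) by vec.
  eapply Rle_trans; [exact (hnorm_triangle _ _)|]. rewrite norm_rscal, Rabs_left; lra.
Qed.

Lemma rip_le_norm x y : rip x y <= norm x * norm y.
Proof. rewrite !norm_inner. exact (cauchy_schwarz inner (inner_is_ip H) x y). Qed.

Lemma Rabs_rip_le_norm x y : Rabs (rip x y) <= norm x * norm y.
Proof.
  apply Rabs_le. split; [|apply rip_le_norm].
  pose proof (rip_le_norm (scal (RtoC (-1)) x) y) as k.
  rewrite norm_rscal, Rabs_left in k by lra. rip_expand_in k. lra.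
Qed.

(** The passage from weak to norm estimates: a bound on [rip x z] proportional to [norm z] is
    applied at [z = x]. *)
Lemma norm_le_of_sqr x (c : R) : 0 <= c -> rip x x <= c * norm x -> norm x <= c.
Proof.
  intros hc h. rewrite <- norm_sqr in h.
  pose proof (norm_ge_0 x). destruct (Req_dec (norm x) 0); [lra|]. nra.
Qed.

Lemma ball_norm_le x y (eps : posreal) : norm (minus y x) < eps -> ball x eps y.
Proof. exact (norm_compat1 x y eps). Qed.

Lemma locally_norm_lt x (eps : R) : 0 < eps -> locally x (fun y => norm (minus y x) < eps).
Proof.
  intros he. apply (@locally_le_locally_norm _ H). exists (mkposreal _ he). intros y h. exact h.
Qed.

Lemma dense_norm (D : H -> Prop) x (eps : R) :
  dense D -> 0 < eps -> exists y, D y /\ norm (minus x y) < eps.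
Proof.
  intros hD he. destruct (hD x _ (locally_norm_lt x eps he)) as (y & h1 & h2).
  exists y. rewrite norm_minus_sym. tauto.
Qed.

Lemma hilbert_complete (u : nat -> H) :
  (forall eps, 0 < eps -> exists N, forall n m, (N <= n)%nat -> (N <= m)%nat ->
     norm (minus (u n) (u m)) < eps) ->
  exists l, forall eps, 0 < eps -> exists N, forall n, (N <= n)%nat ->
     norm (minus (u n) l) < eps.
Proof.
  intros hu.
  destruct (proj1 (filterlim_locally_cauchy (F := eventually) (U := H) u)) as [l hl].
  - intros eps. destruct (hu eps (cond_pos eps)) as [N hN].
    exists (fun n => (N <= n)%nat). split; [exists N; auto|].
    intros n m hn hm. apply ball_norm_le. auto.
  - exists l. intros eps he. exact (hl _ (locally_norm_lt l eps he)).
Qed.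

Lemma bounded_linear_minus {K : Hilbert} (f : K -> H) (hf : is_linear f) (x y : K) :
  f (minus x y) = minus (f x) (f y).
Proof.
  assert (h : plus (f (minus x y)) (f y) = f x).
  { rewrite <- (linear_plus f hf). f_equal. vec. }
  rewrite <- h. vec.
Qed.

Lemma linear_rzero {K : Hilbert} (f : K -> H) (hf : is_linear f) :
  f zero = zero.
Proof.
  transitivity (f (minus zero zero)); [f_equal; vec|].
  rewrite bounded_linear_minus by assumption. vec.
Qed.

End HilbertSpace.

(** * Projections and contractions *)

Record real_subspace {H : Hilbert} (D : H -> Prop) : Prop := {
  real_subspace_zero : D zero;
  real_subspace_comb : forall (r : R) (x y : H),
    D x -> D y -> D (plus x (scal (RtoC r) y)) }.

(** Membership in the closure; [p] itself may belong to [D]. *)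
Definition limit_point {H : Hilbert} (D : H -> Prop) (p : H) : Prop :=
  forall eps, 0 < eps -> exists x, D x /\ norm (minus p x) < eps.

(** The projection theorem by minimizing the distance from [f] to [D]. Since [D] need not be closed,
    the minimizer [p] is only a limit of a minimizing sequence. The infimum [- m] is obtained as the
    supremum of negated squared distances. *)
Lemma orthogonal_decomposition {H : Hilbert} (D : H -> Prop) (f : H) :
  real_subspace D ->
  exists p q, f = plus p q /\ limit_point D p /\ forall x, D x -> rip q x = 0.
Proof.
  intros hD.
  destruct (completeness (fun r => exists x, D x /\ r = - norm (minus f x) ^ 2))
    as [m [hub hlub]].
  { exists 0. intros r (x & _ & ->). pose proof (pow2_ge_0 (norm (minus f x))). lra. }
  { exists (- norm (minus f zero) ^ 2). exists zero. split; [apply hD|reflexivity]. }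
  assert (hm : forall x, D x -> - m <= norm (minus f x) ^ 2).
  { intros x hx. assert (- norm (minus f x) ^ 2 <= m) by (apply hub; eauto). lra. }
  assert (hex : forall n : nat, exists x, D x /\ norm (minus f x) ^ 2 < - m + / (INR n + 1)).
  { intros n. apply NNPP. intros hn.
    assert (0 < / (INR n + 1)) by (apply Rinv_0_lt_compat; pose proof (pos_INR n); lra).
    assert (m <= m - / (INR n + 1)); [|lra].
    apply hlub. intros r (x & hx & ->).
    destruct (Rlt_le_dec (norm (minus f x) ^ 2) (- m + / (INR n + 1))); [|lra].
    exfalso; eauto. }
  set (s := fun n => proj1_sig (constructive_indefinite_description _ (hex n))).
  assert (hs : forall n, D (s n) /\ norm (minus f (s n)) ^ 2 < - m + / (INR n + 1)).
  { intros n. exact (proj2_sig (constructive_indefinite_description _ (hex n))). }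
  clearbody s.
  assert (hinv : forall eps, 0 < eps -> exists N, forall n, (N <= n)%nat -> / (INR n + 1) < eps).
  { intros eps he. destruct (archimed_cor1 eps he) as (N & h1 & h2). exists N.
    intros n hn. apply Rle_lt_trans with (/ INR N); [|assumption].
    apply Rinv_le_contravar; [apply lt_0_INR; lia|]. apply le_INR in hn. lra. }
  destruct (hilbert_complete s) as [p hp].
  { intros eps he. destruct (hinv (eps ^ 2 / 4)) as [N hN]; [nra|].
    exists N. intros n k hn hk.
    assert (hmid := hm (plus (scal (RtoC (1/2)) (s n)) (scal (RtoC (1/2)) (s k)))).
    (* Parallelogram identity: the midpoint lies in [D], so its squared distance is at least [- m],
       and the minimizing sequence is Cauchy. *)
    assert (par : norm (minus (s n) (s k)) ^ 2 =
      2 * norm (minus f (s n)) ^ 2 + 2 * norm (minus f (s k)) ^ 2 -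
      4 * norm (minus f (plus (scal (RtoC (1/2)) (s n)) (scal (RtoC (1/2)) (s k)))) ^ 2).
    { rewrite !norm_sqr. rip_expand.
      rewrite (rip_sym (s n) f), (rip_sym (s k) f), (rip_sym (s k) (s n)). field. }
    lapply hmid; [clear hmid; intros hmid|].
    - pose proof (proj2 (hs n)). pose proof (proj2 (hs k)).
      pose proof (hN n hn). pose proof (hN k hk).
      apply Rsqr_incrst_0; [|apply norm_ge_0|lra]. rewrite !Rsqr_pow2. lra.
    - replace (plus (scal (RtoC (1/2)) (s n)) (scal (RtoC (1/2)) (s k)))
        with (plus (plus zero (scal (RtoC (1/2)) (s n))) (scal (RtoC (1/2)) (s k))) by vec.
      apply hD; [apply hD|]; [apply hD|apply hs|apply hs]. }
  exists p, (minus f p). split; [vec|]. split.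
  { intros eps he. destruct (hp eps he) as [N hN]. exists (s N). split; [apply hs|].
    rewrite norm_minus_sym. apply hN. lia. }
  intros v hv.
  (* First variation at [p]. As [p] may lie outside [D], the comparison is made at [s n]: half of a
     supposed deficit [g] absorbs the distance from the infimum, the other half the replacement of
     [p] by [s n] in the linear term. *)
  assert (key : forall t, 0 <= - 2 * t * rip (minus f p) v + t ^ 2 * norm v ^ 2).
  { intros t. apply Rnot_lt_le. intros hlt.
    set (g := - (- 2 * t * rip (minus f p) v + t ^ 2 * norm v ^ 2)) in *.
    destruct (hinv (g / 2)) as [N1 hN1]; [unfold g; lra|].
    set (c := 2 * Rabs t * norm v + 1).
    assert (hc : 0 < c).
    { unfold c. pose proof (Rabs_pos t). pose proof (norm_ge_0 v).
      pose proof (Rmult_le_pos _ _ H0 H1). lra. }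
    destruct (hp (g / 2 / c)) as [N2 hN2].
    { apply Rdiv_lt_0_compat; [unfold g; lra | assumption]. }
    set (n := Nat.max N1 N2).
    specialize (hN1 n ltac:(lia)). specialize (hN2 n ltac:(lia)).
    pose proof (hm _ (real_subspace_comb _ hD t _ _ (proj1 (hs n)) hv)) as h1.
    pose proof (proj2 (hs n)) as h2.
    assert (e1 : norm (minus f (plus (s n) (scal (RtoC t) v))) ^ 2 =
      norm (minus f (s n)) ^ 2 - 2 * t * rip (minus f (s n)) v + t ^ 2 * norm v ^ 2).
    { rewrite !norm_sqr. rip_expand. rewrite (rip_sym v f), (rip_sym v (s n)). ring. }
    assert (e2 : rip (minus f p) v = rip (minus f (s n)) v + rip (minus (s n) p) v)
      by (rip_expand; ring).
    assert (h3 : Rabs (2 * t * rip (minus (s n) p) v) <= g / 2).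
    { rewrite !Rabs_mult, (Rabs_right 2) by lra.
      apply Rle_trans with (2 * Rabs t * (g / 2 / c * norm v)).
      - apply Rmult_le_compat_l; [pose proof (Rabs_pos t); lra|].
        eapply Rle_trans; [apply Rabs_rip_le_norm|].
        apply Rmult_le_compat_r; [apply norm_ge_0|lra].
      - replace (2 * Rabs t * (g / 2 / c * norm v)) with ((c - 1) * (g / 2 / c))
          by (unfold c; ring).
        replace (g / 2) with (c * (g / 2 / c)) at 2 by (field; lra).
        apply Rmult_le_compat_r; [|lra].
        apply Rlt_le, Rdiv_lt_0_compat; [unfold g; lra | assumption]. }
    apply Rabs_le_between in h3.
    unfold g in *. rewrite e1 in h1. rewrite e2 in *. lra. }
  set (c := rip (minus f p) v) in *. set (W := norm v ^ 2) in *.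
  assert (hW : 0 <= W) by (unfold W; nra).
  (* The optimal [t] would be [c / W]; adding [1] covers [v = 0] and still leaves a strictly
     negative multiple of [c ^ 2]. *)
  specialize (key (c / (W + 1))).
  replace (- 2 * (c / (W + 1)) * c + (c / (W + 1)) ^ 2 * W)
    with (- (c ^ 2 * ((W + 2) / (W + 1) ^ 2))) in key by (field; lra).
  assert (0 < (W + 2) / (W + 1) ^ 2) by (apply Rdiv_lt_0_compat; nra).
  apply Rsqr_0_uniq. rewrite Rsqr_pow2. nra.
Qed.

Lemma contraction_fixed_point {H : Hilbert} (F : H -> H) (q : R) :
  0 <= q < 1 ->
  (forall x y, norm (minus (F x) (F y)) <= q * norm (minus x y)) ->
  exists x, F x = x.
Proof.
  intros hq hF.
  set (it := fix it n x := match n with O => x | S n => it n (F x) end).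
  assert (itF : forall n x, it n (F x) = F (it n x)).
  { induction n; intros x; simpl; [reflexivity|apply IHn]. }
  assert (itD : forall n m x, it (n + m)%nat x = it n (it m x)).
  { induction n; intros m x; simpl; [reflexivity|].
    rewrite IHn, !itF. reflexivity. }
  (* Quantifying over the starting point replaces the geometric series: the bound [d / (1 - q)]
     reproduces itself as [d + q d / (1 - q)]. *)
  assert (h1 : forall n x, norm (minus x (it n x)) <= norm (minus x (F x)) / (1 - q)).
  { induction n; intros x; simpl.
    - replace (minus x x) with (scal (RtoC 0) x) by vec. rewrite norm_rscal, Rabs_R0.
      pose proof (norm_ge_0 (minus x (F x))).
      rewrite Rmult_0_l. apply Rdiv_le_0_compat; lra.
    - rewrite itF. eapply Rle_trans; [apply norm_minus_triangle with (y := F x)|].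
      eapply Rle_trans; [apply Rplus_le_compat_l, hF|].
      specialize (IHn x).
      apply Rmult_le_compat_l with (r := q) in IHn; [|lra].
      apply Rle_trans with (norm (minus x (F x)) + q * (norm (minus x (F x)) / (1 - q))); [lra|].
      right. field. lra. }
  assert (h2 : forall n x y, norm (minus (it n x) (it n y)) <= q ^ n * norm (minus x y)).
  { induction n; intros x y; simpl; [lra|]. rewrite !itF.
    eapply Rle_trans; [apply hF|]. rewrite Rmult_assoc. apply Rmult_le_compat_l; [lra|apply IHn]. }
  set (B := norm (minus zero (F zero)) / (1 - q)).
  assert (hB : 0 <= B) by (apply Rdiv_le_0_compat; [apply norm_ge_0|lra]).
  assert (hpow : forall eps, 0 < eps -> exists N, forall n, (N <= n)%nat -> q ^ n * B < eps).
  { intros eps he.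
    destruct (pow_lt_1_zero q) with (y := eps / (B + 1)) as [N hN].
    - rewrite Rabs_right; lra.
    - apply Rdiv_lt_0_compat; lra.
    - exists N. intros n hn. specialize (hN n hn).
      assert (0 <= q ^ n) by (apply pow_le; lra). rewrite Rabs_right in hN by lra.
      apply Rmult_lt_compat_r with (r := B + 1) in hN; [|lra].
      replace (eps / (B + 1) * (B + 1)) with eps in hN by (field; lra). nra. }
  assert (h3 : forall n m, norm (minus (it n zero) (it (n + m)%nat zero)) <= q ^ n * B).
  { intros n m. rewrite itD. eapply Rle_trans; [apply h2|].
    apply Rmult_le_compat_l; [apply pow_le; lra|apply h1]. }
  destruct (hilbert_complete (fun n => it n zero)) as [x hx].
  { intros eps he. destruct (hpow (eps / 2)) as [N hN]; [lra|]. exists N.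
    intros n m hn hm. eapply Rle_lt_trans; [apply norm_minus_triangle with (y := it N zero)|].
    rewrite (norm_minus_sym (it n zero)).
    replace n with (N + (n - N))%nat by lia. replace m with (N + (m - N))%nat by lia.
    pose proof (h3 N (n - N)%nat). pose proof (h3 N (m - N)%nat).
    specialize (hN N (Nat.le_refl N)). lra. }
  exists x. apply norm_minus_eq0.
  apply Rle_antisym; [|apply norm_ge_0].
  apply Rnot_lt_le. intros hlt.
  destruct (hx (norm (minus (F x) x) / 2)) as [N hN]; [lra|].
  pose proof (hN N (Nat.le_refl N)) as k1. pose proof (hN (S N) ltac:(lia)) as k2.
  simpl in k2. rewrite itF in k2.
  pose proof (norm_minus_triangle (F x) (F (it N zero)) x) as k3.
  pose proof (hF x (it N zero)) as k4. rewrite (norm_minus_sym x) in k4.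
  pose proof (norm_ge_0 (minus (it N zero) x)).
  assert (q * norm (minus (it N zero) x) <= norm (minus (it N zero) x)) by nra.
  lra.
Qed.

(** * Quasi-accretive graphs and their resolvents *)

(** What the estimates retain of a sectorial form. Real combinations suffice, since all pairings go
    through [rip]. *)
Record quasi_accretive {H : Hilbert} (kappa : R) (A : H -> H -> Prop) : Prop := {
  graph_comb : forall (r : R) x h y k, A x h -> A y k ->
    A (plus x (scal (RtoC r) y)) (plus h (scal (RtoC r) k));
  graph_accretive : forall x h, A x h -> - kappa * norm x ^ 2 <= rip h x }.

(** Only solvability of [l x + A x = f] is recorded. Uniqueness, and with it real linearity and
    boundedness of [Q], follows from quasi-accretivity when [l > kappa]. *)
Definition resolvent {H : Hilbert} (l : R) (A : H -> H -> Prop) (Q : H -> H) : Prop :=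
  forall f, A (Q f) (minus f (scal (RtoC l) (Q f))).

Lemma bounded_inverse_resolvent {H : Hilbert} (l : R) (A : H -> H -> Prop) Q :
  bounded_inverse (shift_graph l A) Q -> resolvent l A Q.
Proof.
  intros [_ hQ] f. destruct (proj2 (hQ (Q f) f) eq_refl) as (g & h1 & h2).
  replace (minus f (scal (RtoC l) (Q f))) with g; [assumption|].
  transitivity (minus (plus (scal (RtoC l) (Q f)) g) (scal (RtoC l) (Q f))); [vec|].
  rewrite <- h2. reflexivity.
Qed.

Lemma relation_cast {H K : Hilbert} (A : H -> K -> Prop) x x' h h' :
  A x h -> x = x' -> h = h' -> A x' h'.
Proof. intros hx <- <-. exact hx. Qed.

Section Graph.

Context {H : Hilbert} (kappa : R) (A : H -> H -> Prop).
Hypothesis hA : quasi_accretive kappa A.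

Lemma graph_minus x h y k : A x h -> A y k -> A (minus x y) (minus h k).
Proof.
  intros h1 h2.
  apply (relation_cast A _ _ _ _ (graph_comb _ _ hA (-1) _ _ _ _ h1 h2)); vec.
Qed.

(** Pairing the equation with [x] gives [(l - kappa) |x|^2 <= rip f x], to which Cauchy-Schwarz
    applies. *)
Lemma resolvent_estimate (l : R) x f :
  kappa < l -> A x (minus f (scal (RtoC l) x)) -> norm x <= norm f / (l - kappa).
Proof.
  intros hl hx. pose proof (graph_accretive _ _ hA _ _ hx) as k. rip_expand_in k.
  rewrite <- norm_sqr in k.
  pose proof (rip_le_norm f x) as k2. pose proof (norm_ge_0 x) as k3. pose proof (norm_ge_0 f).
  apply Rmult_le_reg_l with (l - kappa); [lra|].
  replace ((l - kappa) * (norm f / (l - kappa))) with (norm f) by (field; lra).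
  destruct (Req_dec (norm x) 0) as [e|e]; [rewrite e; lra|].
  apply Rmult_le_reg_r with (norm x); [lra|]. lra.
Qed.

Lemma resolvent_eq (l : R) x y f :
  kappa < l -> A x (minus f (scal (RtoC l) x)) -> A y (minus f (scal (RtoC l) y)) -> x = y.
Proof.
  intros hl hx hy. apply norm_minus_eq0.
  apply Rle_antisym; [|apply norm_ge_0].
  replace 0 with (norm (zero : H) / (l - kappa)).
  - apply resolvent_estimate; [assumption|].
    apply (relation_cast A _ _ _ _ (graph_minus _ _ _ _ hx hy)); vec.
  - replace (norm (zero : H)) with 0 by (symmetry; exact (norm_zero (V := H))).
    field. lra.
Qed.

Lemma resolvent_plus (l : R) Q f g :
  kappa < l -> resolvent l A Q -> Q (plus f g) = plus (Q f) (Q g).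
Proof.
  intros hl hQ. apply resolvent_eq with (l := l) (f := plus f g); [assumption|apply hQ|].
  apply (relation_cast A _ _ _ _ (graph_comb _ _ hA 1 _ _ _ _ (hQ f) (hQ g))); vec.
Qed.

Lemma resolvent_minus (l : R) Q f g :
  kappa < l -> resolvent l A Q -> Q (minus f g) = minus (Q f) (Q g).
Proof.
  intros hl hQ. apply resolvent_eq with (l := l) (f := minus f g); [assumption|apply hQ|].
  apply (relation_cast A _ _ _ _ (graph_minus _ _ _ _ (hQ f) (hQ g))); vec.
Qed.

Lemma resolvent_scal (l r : R) Q f :
  kappa < l -> resolvent l A Q -> Q (scal (RtoC r) f) = scal (RtoC r) (Q f).
Proof.
  intros hl hQ. apply resolvent_eq with (l := l) (f := scal (RtoC r) f); [assumption|apply hQ|].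
  (* This is the pair [(0, 0)], needed as first summand because [graph_comb] only scales its second
     one. *)
  pose proof (graph_minus _ _ _ _ (hQ f) (hQ f)) as h0.
  apply (relation_cast A _ _ _ _ (graph_comb _ _ hA r _ _ _ _ h0 (hQ f))); vec.
Qed.

Lemma resolvent_lipschitz (l : R) Q f g :
  kappa < l -> resolvent l A Q ->
  norm (minus (Q f) (Q g)) <= norm (minus f g) / (l - kappa).
Proof.
  intros hl hQ. rewrite <- (resolvent_minus l Q) by assumption.
  apply resolvent_estimate; [assumption|apply hQ].
Qed.

Lemma resolvent_norm (l : R) Q f :
  kappa < l -> resolvent l A Q -> norm (Q f) <= norm f / (l - kappa).
Proof.
  intros hl hQ. apply resolvent_estimate; [assumption|apply hQ].
Qed.

Lemma resolvent_of_graph (l : R) Q x h :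
  kappa < l -> resolvent l A Q -> A x h -> x = Q (plus h (scal (RtoC l) x)).
Proof.
  intros hl hQ hx. apply resolvent_eq with (l := l) (f := plus h (scal (RtoC l) x));
    [assumption| |apply hQ].
  apply (relation_cast A _ _ _ _ hx); vec.
Qed.

(* One application of the fixed point theorem reaches every [l > kappa],
   since [(l' - l) / (l' - kappa) < 1]. *)
Lemma resolvent_decrease (l l' : R) Q :
  kappa < l -> l <= l' -> resolvent l' A Q -> exists Q', resolvent l A Q'.
Proof.
  intros hl hl' hQ.
  assert (hex : forall f, exists x, A x (minus f (scal (RtoC l) x))).
  { intros f.
    destruct (contraction_fixed_point
      (fun u => Q (plus f (scal (RtoC (l' - l)) u))) ((l' - l) / (l' - kappa))) as [x hx].
    - split; [apply Rdiv_le_0_compat; lra|].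
      apply Rmult_lt_reg_r with (l' - kappa); [lra|]. field_simplify; lra.
    - intros x y. eapply Rle_trans; [apply (resolvent_lipschitz l'); [lra|assumption]|].
      rewrite (norm_eq_rscal (l' - l) (minus x y)) by vec.
      rewrite Rabs_right by lra. right. field. lra.
    - exists x. pose proof (hQ (plus f (scal (RtoC (l' - l)) x))) as h.
      rewrite hx in h.
      apply (relation_cast A _ _ _ _ h); vec. }
  exists (fun f => proj1_sig (constructive_indefinite_description _ (hex f))).
  intros f. exact (proj2_sig (constructive_indefinite_description _ (hex f))).
Qed.

End Graph.

(** * Bounded real functionals under the integral sign *)

Record real_functional {H : Hilbert} (l : H -> R) : Prop := {
  functional_plus : forall x y, l (plus x y) = l x + l y;
  functional_scal : forall (r : R) x, l (scal (RtoC r) x) = r * l x;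
  functional_bound : exists M, 0 < M /\ forall x, Rabs (l x) <= M * norm x }.

Lemma real_functional_rip {H K : Hilbert} (f : H -> K) (z : K) :
  is_linear f -> real_functional (fun x => rip (f x) z).
Proof.
  intros hf. split.
  - intros x y. rewrite (linear_plus f hf). rip_expand. reflexivity.
  - intros r x. rewrite (linear_scal f hf). rip_expand. reflexivity.
  - destruct (linear_norm f hf) as (M & h1 & h2). exists (M * (norm z + 1)).
    pose proof (norm_ge_0 z). split; [apply Rmult_lt_0_compat; lra|].
    intros x. eapply Rle_trans; [apply Rabs_rip_le_norm|].
    specialize (h2 x). pose proof (norm_ge_0 (f x)).
    replace (M * (norm z + 1) * norm x) with (M * norm x * (norm z + 1)) by ring. nra.
Qed.

Lemma is_linear_id {H : Hilbert} : is_linear (fun x : H => x).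
Proof. split; [reflexivity|reflexivity|]. exists 1. split; [lra|]. intros x. lra. Qed.

Section Functional.

Context {H : Hilbert} (l : H -> R) (hl : real_functional l).

Lemma functional_zero : l zero = 0.
Proof.
  replace (zero : H) with (scal (RtoC 0) (zero : H)) by vec.
  rewrite (functional_scal _ hl). ring.
Qed.

Lemma functional_minus x y : l (minus x y) = l x - l y.
Proof.
  replace (minus x y) with (plus x (scal (RtoC (-1)) y)) by vec.
  rewrite (functional_plus _ hl), (functional_scal _ hl). ring.
Qed.

Lemma functional_filterlim x : filterlim l (locally x) (locally (l x)).
Proof.
  destruct (functional_bound _ hl) as (M & hM & hb).
  apply filterlim_locally. intros eps.
  apply filter_imp with (fun y : H => norm (minus y x) < eps / M).
  - intros y hy. change (Rabs (minus (l y) (l x)) < eps).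
    change (Rabs (l y - l x) < eps). rewrite <- functional_minus.
    eapply Rle_lt_trans; [apply hb|].
    apply Rmult_lt_compat_l with (r := M) in hy; [|assumption].
    replace (M * (eps / M)) with (pos eps) in hy by (field; lra). exact hy.
  - apply locally_norm_lt. apply Rdiv_lt_0_compat; [apply cond_pos|assumption].
Qed.

Lemma functional_Riemann_sum (phi : R -> H) (ptd : SF_seq) :
  l (@Riemann_sum (NormedModule.ModuleSpace _ (real_NormedModule H)) phi ptd) =
  Riemann_sum (fun s => l (phi s)) ptd.
Proof.
  apply (SF_cons_ind (fun ptd =>
    l (@Riemann_sum (NormedModule.ModuleSpace _ (real_NormedModule H)) phi ptd)
    = Riemann_sum (fun s => l (phi s)) ptd)).
  - intros x. exact functional_zero.
  - intros h s IH. rewrite !Riemann_sum_cons. rewrite <- IH.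
    etransitivity; [exact (functional_plus _ hl _ _)|].
    exact (f_equal2 Rplus (functional_scal _ hl _ _) eq_refl).
Qed.

(** A bounded functional commutes with Riemann sums and with their limits. With
    [l x = rip (S t x) z] this also moves the operator [S t] through the Laplace integral. *)
Lemma functional_is_RInt_gen (phi : R -> H) Fa Fb (y : H) :
  @is_RInt_gen (real_NormedModule H) phi Fa Fb y ->
  is_RInt_gen (fun s => l (phi s)) Fa Fb (l y).
Proof.
  intros hphi P hP.
  destruct (hphi _ (functional_filterlim y P hP)) as [Q R0 hQ hR h].
  exists Q R0; [assumption|assumption|].
  intros a b ha hb. destruct (h a b ha hb) as (w & hw & hw').
  exists (l w). split; [|assumption].
  unfold is_RInt in *.
  apply filterlim_ext with (fun ptd : SF_seq =>
    l (@scal _ (NormedModule.ModuleSpace _ (real_NormedModule H)) (sign (b - a))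
    (@Riemann_sum (NormedModule.ModuleSpace _ (real_NormedModule H)) phi ptd))).
  - intros ptd. rewrite <- functional_Riemann_sum. exact (functional_scal _ hl _ _).
  - eapply filterlim_comp; [exact hw|]. exact (functional_filterlim w).
Qed.

End Functional.

(** * Orbits of a generated semigroup *)

Lemma antiderivative_exists (psi : R -> R) :
  (forall s, 0 < s -> continuous psi s) ->
  exists G, forall s, 0 < s -> is_derive G s (psi s).
Proof.
  (* The base point is [1], not [0], since continuity is only known on the open half-line. *)
  intros hpsi. exists (fun t => RInt psi 1 t). intros s hs.
  apply is_derive_RInt with (a := 1); [|apply hpsi; assumption].
  apply filter_imp with (fun b : R => 0 < b).
  - intros b hb. apply (RInt_correct (V := R_CompleteNormedModule)),
      (ex_RInt_continuous (V := R_CompleteNormedModule)). intros z hz.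
    apply hpsi. eapply Rlt_le_trans; [|apply hz]. apply Rmin_glb_lt; lra.
  - exact (open_gt 0 s hs).
Qed.

(** The improper integral of [G'] over the half-line equals [c], expressed through the
    antiderivative alone. *)
Definition improper_limit (G : R -> R) (c : R) : Prop :=
  forall eps, 0 < eps -> exists delta M, 0 < delta /\
    forall a b, 0 < a < delta -> M < b -> Rabs (G b - G a - c) < eps.

Lemma improper_limit_unique G c c' :
  improper_limit G c -> improper_limit G c' -> c = c'.
Proof.
  intros h h'. apply Rminus_diag_uniq, Rabs_eq_0.
  apply Rle_antisym; [|apply Rabs_pos]. apply Rnot_lt_le. intros hlt.
  destruct (h (Rabs (c - c') / 2)) as (d & M & hd & k); [lra|].
  destruct (h' (Rabs (c - c') / 2)) as (d' & M' & hd' & k'); [lra|].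
  assert (ha : 0 < Rmin d d') by (apply Rmin_glb_lt; assumption).
  pose proof (Rmin_l d d'). pose proof (Rmin_r d d').
  pose proof (Rmax_l M M'). pose proof (Rmax_r M M').
  specialize (k (Rmin d d' / 2) (Rmax M M' + 1) ltac:(lra) ltac:(lra)).
  specialize (k' (Rmin d d' / 2) (Rmax M M' + 1) ltac:(lra) ltac:(lra)).
  pose proof (Rabs_triang_inv (c - c') (G (Rmax M M' + 1) - G (Rmin d d' / 2) - c')) as k3.
  replace (c - c' - (G (Rmax M M' + 1) - G (Rmin d d' / 2) - c'))
    with (- (G (Rmax M M' + 1) - G (Rmin d d' / 2) - c)) in k3 by ring.
  rewrite Rabs_Ropp in k3. lra.
Qed.

(* [F t] is the Laplace integral of the shifted function, so it only depends
   on the tail of the integral beyond [t]. *)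
Lemma improper_limit_shift (G : R -> R) (c : R) (F : R -> R) :
  (forall s, 0 < s -> continuous G s) ->
  improper_limit G c ->
  (forall t, 0 < t -> improper_limit (fun s => G (t + s)) (F t)) ->
  exists K, (forall t, 0 < t -> F t = K - G t) /\
    forall eps, 0 < eps -> exists delta, 0 < delta /\
      forall a, 0 < a < delta -> Rabs (K - G a - c) < eps.
Proof.
  intros hG hc hF.
  (* Both limits are approximated at the same upper endpoint [t + b], so the value of [G] there
     cancels. What remains shows that [F t + G t] does not depend on [t]. *)
  assert (key : forall t eps, 0 < t -> 0 < eps -> exists delta, 0 < delta /\
    forall a, 0 < a < delta -> Rabs (F t + G t - G a - c) < eps).
  { intros t eps ht he.
    destruct (hc (eps / 3)) as (d & M & hd & h); [lra|].
    destruct (hF t ht (eps / 3)) as (d' & M' & hd' & h'); [lra|].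
    destruct (proj1 (filterlim_locally _ _) (hG t ht) (mkposreal (eps / 3) ltac:(lra)))
      as [d'' hd''].
    exists d. split; [assumption|]. intros a ha.
    set (b := Rmax M M' + 1). pose proof (Rmax_l M M'). pose proof (Rmax_r M M').
    set (a' := Rmin (d' / 2) (d'' / 2)).
    assert (ha' : 0 < a') by (apply Rmin_glb_lt; [lra | pose proof (cond_pos d''); lra]).
    pose proof (Rmin_l (d' / 2) (d'' / 2)). pose proof (Rmin_r (d' / 2) (d'' / 2)).
    specialize (h a (t + b) ha ltac:(unfold b; lra)).
    specialize (h' a' b ltac:(unfold a' in *; lra) ltac:(unfold b; lra)).
    assert (h'' : Rabs (G (t + a') - G t) < eps / 3).
    { apply (hd'' (t + a')). change (Rabs (t + a' - t) < d'').
      rewrite Rabs_right; unfold a' in *; pose proof (cond_pos d''); lra. }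
    apply Rabs_def2 in h. apply Rabs_def2 in h'. apply Rabs_def2 in h''.
    apply Rabs_def1; lra. }
  assert (const : forall t, 0 < t -> F t + G t = F 1 + G 1).
  { intros t ht. apply Rminus_diag_uniq, Rabs_eq_0.
    apply Rle_antisym; [|apply Rabs_pos]. apply Rnot_lt_le. intros hlt.
    set (e := Rabs (F t + G t - (F 1 + G 1))) in *.
    destruct (key t (e / 2) ht) as (d & hd & h); [lra|].
    destruct (key 1 (e / 2) ltac:(lra)) as (d' & hd' & h'); [lra|].
    assert (ha : 0 < Rmin d d') by (apply Rmin_glb_lt; assumption).
    pose proof (Rmin_l d d'). pose proof (Rmin_r d d').
    specialize (h (Rmin d d' / 2) ltac:(lra)).
    specialize (h' (Rmin d d' / 2) ltac:(lra)).
    assert (e < e); [|lra]. unfold e at 1.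
    apply Rabs_def2 in h. apply Rabs_def2 in h'. apply Rabs_def1; lra. }
  exists (F 1 + G 1). split.
  - intros t ht. rewrite <- (const t ht). ring.
  - intros eps he. destruct (key 1 eps ltac:(lra) he) as (d & hd & h).
    exists d. split; assumption.
Qed.

Section Semigroup.

Context {H : Hilbert} (A : H -> H -> Prop) (S : R -> H -> H).
Hypothesis S_sg : degenerate_semigroup S.

Lemma functional_semigroup_continuous (l : H -> R) (lambda : R) (g : H) (t : R) :
  real_functional l -> 0 < t -> continuous (fun s => exp (- lambda * s) * l (S s g)) t.
Proof.
  intros hl ht.
  apply (continuous_mult (K := R_AbsRing) (fun s => exp (- lambda * s)) (fun s => l (S s g))).
  - apply (ex_derive_continuous (fun s => exp (- lambda * s))). auto_derive. exact I.
  - eapply filterlim_comp; [exact (semigroup_continuous _ S_sg g t ht)|].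
    apply functional_filterlim. assumption.
Qed.

Lemma laplace_improper_limit (l : H -> R) (lambda : R) (g y : H) (G : R -> R) :
  real_functional l ->
  @is_RInt_gen (real_NormedModule H)
    (fun t : R => scal (RtoC (exp (- lambda * t))) (S t g))
    (at_right 0) (Rbar_locally p_infty) y ->
  (forall s, 0 < s -> is_derive G s (exp (- lambda * s) * l (S s g))) ->
  improper_limit G (l y).
Proof.
  intros hl hy hG eps he.
  pose proof (functional_is_RInt_gen l hl _ _ _ _ hy) as h.
  destruct (h (fun r => Rabs (r - l y) < eps)) as [P Q hP hQ hPQ].
  { exists (mkposreal eps he). intros r hr. exact hr. }
  destruct hP as [d hd]. destruct hQ as [M hM].
  exists d, (Rmax M 0). split; [apply cond_pos|]. intros a b ha hb.
  pose proof (Rmax_l M 0). pose proof (Rmax_r M 0).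
  destruct (hPQ a b) as (w & hw & hwe).
  - apply hd; [|lra]. change (Rabs (a - 0) < d). rewrite Rabs_right; lra.
  - apply hM. lra.
  - simpl in hw. replace (G b - G a) with w; [exact hwe|].
    rewrite <- (is_RInt_unique _ _ _ _ hw). apply is_RInt_unique.
    apply is_RInt_ext with (fun s => exp (- lambda * s) * l (S s g)).
    + intros s _. symmetry. apply (functional_scal _ hl).
    + apply (is_RInt_derive G).
      * intros s hs. apply hG. eapply Rlt_le_trans; [|apply hs]. apply Rmin_glb_lt; lra.
      * intros s hs. apply functional_semigroup_continuous; [assumption|].
        eapply Rlt_le_trans; [|apply hs]. apply Rmin_glb_lt; lra.
Qed.

Hypothesis S_gen : neg_generator A S.

Lemma semigroup_comm s t x : 0 < s -> 0 < t -> S s (S t x) = S t (S s x).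
Proof.
  intros hs ht. rewrite <- !(semigroup_law _ S_sg) by assumption.
  rewrite Rplus_comm. reflexivity.
Qed.

(** [S t] commutes with the Laplace transform of [S], hence with the resolvent: tested against [z],
    the vectors [S t (Q g)] and [Q (S t g)] are improper integrals with one antiderivative [G]. *)
Lemma semigroup_graph x h t : A x h -> 0 < t -> A (S t x) (S t h).
Proof.
  intros hx ht. destruct S_gen as [omega hgen].
  destruct (hgen (omega + 1) ltac:(lra)) as (Q & [_ hQ] & hint).
  set (lam := omega + 1) in *. set (g := plus (scal (RtoC lam) x) h).
  assert (hxg : x = Q g) by (apply hQ; exists h; auto).
  assert (hcomm : S t x = Q (S t g)).
  { apply (re_ip_ext _ (inner_is_ip H)). intros z.
    destruct (antiderivative_exists
      (fun s => exp (- lam * s) * rip (S s (S t g)) z)) as [G hG].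
    { intros s hs. apply (functional_semigroup_continuous (fun y => rip y z)); [|assumption].
      apply real_functional_rip with (f := fun y => y), is_linear_id. }
    apply improper_limit_unique with G.
    - rewrite hxg. apply (laplace_improper_limit (fun y => rip (S t y) z) lam g (Q g)).
      + apply real_functional_rip, (semigroup_bounded_op _ S_sg t ht).
      + apply hint.
      + intros s hs. rewrite <- semigroup_comm by assumption. apply hG. assumption.
    - apply (laplace_improper_limit (fun y => rip y z) lam (S t g)).
      + apply real_functional_rip with (f := fun y => y), is_linear_id.
      + apply hint.
      + exact hG. }
  destruct (proj2 (hQ _ _) hcomm) as (k & hk & e).
  apply (relation_cast A _ _ _ _ hk); [reflexivity|].
  pose proof (semigroup_bounded_op _ S_sg t ht) as hlin.
  transitivity (minus (S t g) (scal (RtoC lam) (S t x))).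
  - rewrite e. vec.
  - unfold g. rewrite (linear_plus _ hlin), (linear_scal _ hlin). vec.
Qed.

(** Writing [x = Q g], the semigroup law turns [exp (- lam t) S t x] into the integral of
    [exp (- lam s) S s g] over [s > t]. The fundamental theorem of calculus gives the derivative,
    and letting [t] tend to [0] restores the whole integral, namely [x]. *)
Lemma semigroup_weak_derivative x h z :
  A x h ->
  (forall t, 0 < t -> is_derive (fun s => rip (S s x) z) t (- rip (S t h) z)) /\
  (forall eps, 0 < eps -> exists delta, 0 < delta /\
    forall t, 0 < t < delta -> Rabs (rip (S t x) z - rip x z) < eps).
Proof.
  intros hx. destruct S_gen as [omega hgen].
  destruct (hgen (omega + 1) ltac:(lra)) as (Q & [_ hQ] & hint).
  set (lam := omega + 1) in *. set (g := plus (scal (RtoC lam) x) h).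
  assert (hxg : x = Q g) by (apply hQ; exists h; auto).
  assert (hrip : real_functional (fun y : H => rip y z))
    by apply real_functional_rip with (f := fun y => y), is_linear_id.
  destruct (antiderivative_exists (fun s => exp (- lam * s) * rip (S s g) z)) as [G hG].
  { intros s hs. apply (functional_semigroup_continuous (fun y => rip y z)); assumption. }
  destruct (improper_limit_shift G (rip x z) (fun t => exp (- lam * t) * rip (S t x) z))
    as (K & hK & hK0).
  - intros s hs. apply (ex_derive_continuous G). eexists. apply hG. assumption.
  - rewrite hxg. apply (laplace_improper_limit (fun y => rip y z) lam g); auto.
  - intros t ht.
    (* The substitution [s -> t + s] in the Laplace integral produces the factor [exp (lam t)]. *)
    assert (hlim : improper_limit (fun s => exp (lam * t) * G (t + s)) (rip (S t x) z)).
    { rewrite hxg at 1.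
      apply (laplace_improper_limit (fun y => rip (S t y) z) lam g (Q g)).
      - apply real_functional_rip, (semigroup_bounded_op _ S_sg t ht).
      - apply hint.
      - intros s hs. rewrite <- (semigroup_law _ S_sg) by assumption.
        replace (exp (- lam * s) * rip (S (t + s) g) z)
          with (exp (lam * t) * (1 * (exp (- lam * (t + s)) * rip (S (t + s) g) z))).
        + apply is_derive_scal. apply (is_derive_comp G (fun s => t + s)).
          * apply hG. lra.
          * auto_derive; [exact I|ring].
        + rewrite Rmult_1_l, <- Rmult_assoc, <- exp_plus. f_equal. f_equal. ring. }
    intros eps he.
    destruct (hlim (exp (lam * t) * eps)) as (d & M & hd & hdM).
    { apply Rmult_lt_0_compat; [apply exp_pos|assumption]. }
    exists d, M. split; [assumption|]. intros a b ha hb. specialize (hdM a b ha hb).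
    apply Rmult_lt_reg_l with (exp (lam * t)); [apply exp_pos|].
    rewrite <- (Rabs_right (exp (lam * t))) at 1 by (apply Rle_ge, Rlt_le, exp_pos).
    rewrite <- Rabs_mult.
    replace (exp (lam * t) * (G (t + b) - G (t + a) - exp (- lam * t) * rip (S t x) z))
      with (exp (lam * t) * G (t + b) - exp (lam * t) * G (t + a) -
        (exp (lam * t) * exp (- lam * t)) * rip (S t x) z) by ring.
    rewrite <- exp_plus. replace (lam * t + - lam * t) with 0 by ring.
    rewrite exp_0, Rmult_1_l. exact hdM.
  - assert (hval : forall t, 0 < t -> rip (S t x) z = exp (lam * t) * (K - G t)).
    { intros t ht. rewrite <- (hK t ht), <- Rmult_assoc, <- exp_plus.
      replace (lam * t + - lam * t) with 0 by ring. rewrite exp_0. ring. }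
    split.
    + intros t ht.
      apply is_derive_ext_loc with (fun s => exp (lam * s) * (K - G s)).
      { apply filter_imp with (fun s : R => 0 < s); [|exact (open_gt 0 t ht)].
        intros s hs. symmetry. apply hval. assumption. }
      (* The product rule yields [lam S t x - S t g], and [g = lam x + h]. *)
      replace (- rip (S t h) z) with
        (lam * exp (lam * t) * (K - G t) +
         exp (lam * t) * (0 - exp (- lam * t) * rip (S t g) z)).
      * apply (is_derive_mult (fun s => exp (lam * s)) (fun s => K - G s)).
        -- auto_derive; [exact I|ring].
        -- apply (is_derive_minus (fun _ => K) G).
           ++ exact (@is_derive_const R_AbsRing R_NormedModule K t).
           ++ apply hG. assumption.
        -- intros u v. apply Rmult_comm.
      * pose proof (semigroup_bounded_op _ S_sg t ht) as hlin.
        unfold g. rewrite (linear_plus _ hlin), (linear_scal _ hlin). rip_expand.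
        rewrite (Rmult_assoc lam), <- hval by assumption.
        replace (exp (lam * t) * (0 - exp (- lam * t) *
          (lam * rip (S t x) z + rip (S t h) z))) with
          (- (exp (lam * t) * exp (- lam * t)) * (lam * rip (S t x) z + rip (S t h) z)) by ring.
        rewrite <- exp_plus. replace (lam * t + - lam * t) with 0 by ring.
        rewrite exp_0. ring.
    + intros eps he.
      assert (l1 : filterlim (fun t => exp (lam * t)) (at_right 0) (locally 1)).
      { replace 1 with (exp (lam * 0)) by (rewrite Rmult_0_r; apply exp_0).
        eapply filterlim_filter_le_1; [apply filter_le_within|].
        apply (ex_derive_continuous (fun t => exp (lam * t))). auto_derive. exact I. }
      assert (l2 : filterlim (fun t => K - G t) (at_right 0) (locally (rip x z))).
      { apply filterlim_locally. intros e.
        destruct (hK0 e (cond_pos e)) as (d & hd & k).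
        exists (mkposreal d hd). intros t ht ht0. apply k. split; [assumption|].
        change (Rabs (t - 0) < d) in ht. rewrite Rabs_right in ht; lra. }
      pose proof (filterlim_comp_2 _ _ Rmult l1 l2
        (filterlim_mult (K := R_AbsRing) 1 (rip x z))) as l3.
      destruct (proj1 (filterlim_locally _ _) l3 (mkposreal eps he)) as [d hd].
      exists d. split; [apply cond_pos|]. intros t ht. rewrite hval by lra.
      specialize (hd t). change (Rabs (t - 0) < d -> 0 < t ->
        Rabs (exp (lam * t) * (K - G t) - 1 * rip x z) < eps) in hd.
      rewrite Rmult_1_l in hd. apply hd; [rewrite Rabs_right|]; lra.
Qed.

End Semigroup.

(** * Energy estimates *)

Section Derivative.

Context {H : Hilbert}.

Definition has_derivative (F : R -> H) (t : R) (d : H) : Prop :=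
  forall eps, 0 < eps -> exists delta, 0 < delta /\ forall s, Rabs (s - t) < delta ->
    norm (minus (minus (F s) (F t)) (scal (RtoC (s - t)) d)) <= eps * Rabs (s - t).

(** The scalar mean value theorem is applied to [rip (F s) z] with [z] the defect to be estimated.
    The intermediate point depends on [z], but the bound on [D] is uniform. *)
Lemma weak_increment (F D : R -> H) (a b eps : R) (d : H) :
  (forall r z, Rmin a b <= r <= Rmax a b ->
    is_derive (fun s => rip (F s) z) r (rip (D r) z)) ->
  (forall r, Rmin a b <= r <= Rmax a b -> norm (minus (D r) d) <= eps) ->
  norm (minus (minus (F b) (F a)) (scal (RtoC (b - a)) d)) <= eps * Rabs (b - a).
Proof.
  intros hF hD. set (z := minus (minus (F b) (F a)) (scal (RtoC (b - a)) d)).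
  destruct (MVT_gen (fun s => rip (F s) z) a b (fun r => rip (D r) z)) as (c & hc & e).
  - intros r hr. apply hF. lra.
  - intros r hr. apply continuity_pt_filterlim.
    apply (ex_derive_continuous (fun s => rip (F s) z)). eexists. apply hF. assumption.
  - specialize (hD c hc).
    assert (0 <= eps) by exact (Rle_trans _ _ _ (hnorm_ge_0 _) hD).
    apply norm_le_of_sqr; [apply Rmult_le_pos; [assumption|apply Rabs_pos]|].
    assert (e2 : rip z z = (b - a) * rip (minus (D c) d) z).
    { unfold z at 1. rip_expand. rewrite e. ring. }
    rewrite e2. eapply Rle_trans; [apply Rle_abs|]. rewrite Rabs_mult.
    rewrite (Rmult_comm eps), Rmult_assoc. apply Rmult_le_compat_l; [apply Rabs_pos|].
    eapply Rle_trans; [apply Rabs_rip_le_norm|].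
    apply Rmult_le_compat_r; [apply hnorm_ge_0|assumption].
Qed.

Lemma weak_lipschitz (F D : R -> H) (a b c : R) :
  (forall r z, Rmin a b <= r <= Rmax a b ->
    is_derive (fun s => rip (F s) z) r (rip (D r) z)) ->
  (forall r, Rmin a b <= r <= Rmax a b -> norm (D r) <= c) ->
  norm (minus (F b) (F a)) <= c * Rabs (b - a).
Proof.
  intros hF hD.
  apply (norm_le_eq (minus (minus (F b) (F a)) (scal (RtoC (b - a)) zero))); [|vec].
  apply weak_increment with D; [assumption|].
  intros r hr. apply (norm_le_eq (D r)); [apply hD; assumption|vec].
Qed.

Lemma has_derivative_minus F G t d d' :
  has_derivative F t d -> has_derivative G t d' ->
  has_derivative (fun s => minus (F s) (G s)) t (minus d d').
Proof.
  intros h h' eps he.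
  destruct (h (eps / 2)) as (e & h1 & h2); [lra|].
  destruct (h' (eps / 2)) as (e' & h1' & h2'); [lra|].
  exists (Rmin e e'). split; [apply Rmin_glb_lt; assumption|]. intros s hs.
  pose proof (Rmin_l e e'). pose proof (Rmin_r e e').
  specialize (h2 s ltac:(lra)). specialize (h2' s ltac:(lra)).
  eapply norm_le_eq; [eapply Rle_trans; [apply (norm_minus_le
    (minus (minus (F s) (F t)) (scal (RtoC (s - t)) d))
    (minus (minus (G s) (G t)) (scal (RtoC (s - t)) d')))|]|vec].
  lra.
Qed.

Lemma has_derivative_map (Q : H -> H) (c : R) F t d :
  0 < c ->
  (forall x y, Q (minus x y) = minus (Q x) (Q y)) ->
  (forall (r : R) x, Q (scal (RtoC r) x) = scal (RtoC r) (Q x)) ->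
  (forall x, norm (Q x) <= c * norm x) ->
  has_derivative F t d -> has_derivative (fun s => Q (F s)) t (Q d).
Proof.
  intros hc hm hs hb h eps he.
  destruct (h (eps / c)) as (e & h1 & h2); [apply Rdiv_lt_0_compat; assumption|].
  exists e. split; [assumption|]. intros s hst. specialize (h2 s hst).
  rewrite <- hs, <- !hm. eapply Rle_trans; [apply hb|].
  apply Rmult_le_compat_l with (r := c) in h2; [|lra].
  replace (c * (eps / c * Rabs (s - t))) with (eps * Rabs (s - t)) in h2 by (field; lra).
  exact h2.
Qed.

Lemma has_derivative_norm_sqr F t d :
  has_derivative F t d -> is_derive (fun s => norm (F s) ^ 2) t (2 * rip d (F t)).
Proof.
  intros h. apply is_derive_Reals. intros eps he.
  pose proof (hnorm_ge_0 (F t)) as nF. pose proof (hnorm_ge_0 d) as nd.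
  (* Expanding the square leaves [2 rip r (F t)] and [|k d + r|^2]. The second entry of [eta] bounds
     the former by [|k| eps / 2]; [eta <= 1] and the [e'] below bound the latter by the same
     amount. *)
  set (eta := Rmin 1 (eps / 4 / (norm (F t) + 1))).
  assert (heta : 0 < eta).
  { apply Rmin_glb_lt; [lra|]. apply Rdiv_lt_0_compat; lra. }
  assert (heta1 : eta <= 1) by apply Rmin_l.
  assert (heta2 : eta * (norm (F t) + 1) <= eps / 4).
  { apply Rle_trans with (eps / 4 / (norm (F t) + 1) * (norm (F t) + 1)).
    - apply Rmult_le_compat_r; [lra|apply Rmin_r].
    - right. field. lra. }
  destruct (h eta heta) as (e & he1 & he2).
  set (e' := eps / 2 / (norm d + 1) ^ 2).
  assert (he' : 0 < e') by (apply Rdiv_lt_0_compat; [lra|apply pow_lt; lra]).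
  assert (hm : 0 < Rmin e e') by (apply Rmin_glb_lt; assumption).
  exists (mkposreal _ hm). intros k hk hkd. simpl in hkd.
  pose proof (Rmin_l e e'). pose proof (Rmin_r e e').
  specialize (he2 (t + k)). replace (t + k - t) with k in he2 by ring.
  specialize (he2 ltac:(lra)).
  set (r := minus (minus (F (t + k)) (F t)) (scal (RtoC k) d)) in *.
  assert (hka : 0 < Rabs k) by (apply Rabs_pos_lt; assumption).
  assert (hr1 : norm (plus (scal (RtoC k) d) r) <= Rabs k * (norm d + 1)).
  { eapply Rle_trans; [exact (hnorm_triangle _ _)|]. rewrite norm_rscal. nra. }
  assert (e1 : norm (F (t + k)) ^ 2 - norm (F t) ^ 2 - k * (2 * rip d (F t)) =
    2 * rip r (F t) + norm (plus (scal (RtoC k) d) r) ^ 2).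
  { replace (plus (scal (RtoC k) d) r) with (minus (F (t + k)) (F t)) by (unfold r; vec).
    rewrite !norm_sqr. unfold r. rip_expand. rewrite (rip_sym (F t) (F (t + k))). ring. }
  replace ((norm (F (t + k)) ^ 2 - norm (F t) ^ 2) / k - 2 * rip d (F t))
    with ((2 * rip r (F t) + norm (plus (scal (RtoC k) d) r) ^ 2) / k)
    by (rewrite <- e1; field; assumption).
  unfold Rdiv. rewrite Rabs_mult, Rabs_inv.
  apply Rmult_lt_reg_r with (Rabs k); [assumption|].
  rewrite Rmult_assoc, Rinv_l, Rmult_1_r by lra.
  eapply Rle_lt_trans; [apply Rabs_triang|].
  rewrite Rabs_mult, (Rabs_right 2) by lra.
  rewrite (Rabs_right (norm _ ^ 2)) by (apply Rle_ge, pow2_ge_0).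
  pose proof (Rabs_rip_le_norm r (F t)) as h3.
  pose proof (hnorm_ge_0 r). pose proof (hnorm_ge_0 (plus (scal (RtoC k) d) r)) as h5.
  assert (h4 : norm (plus (scal (RtoC k) d) r) ^ 2 <= (Rabs k * (norm d + 1)) ^ 2)
    by (apply pow_incr; split; assumption).
  assert (h6 : Rabs k * (norm d + 1) ^ 2 < eps / 2).
  { apply Rlt_le_trans with (e' * (norm d + 1) ^ 2).
    - apply Rmult_lt_compat_r; [apply pow_lt|]; lra.
    - right. unfold e'. field. lra. }
  assert (h7 : norm r * norm (F t) <= Rabs k * (eps / 4)).
  { apply Rle_trans with (eta * Rabs k * (norm (F t) + 1)).
    - apply Rmult_le_compat; lra.
    - rewrite (Rmult_comm eta), Rmult_assoc. apply Rmult_le_compat_l; lra. }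
  assert (h8 : (Rabs k * (norm d + 1)) ^ 2 < Rabs k * (eps / 2)).
  { replace ((Rabs k * (norm d + 1)) ^ 2) with (Rabs k * (Rabs k * (norm d + 1) ^ 2)) by ring.
    apply Rmult_lt_compat_l; assumption. }
  lra.
Qed.

End Derivative.

(** The function [exp (- c s) (N s + m)] decreases, because [c >= 1] gives [m <= c m]; this keeps
    [T] out of the constant. [N] is only controlled for [s > 0], so an initial value is replaced by
    the bound [B + eps] near [0]. *)
Lemma gronwall (N N' : R -> R) (T c m B : R) :
  1 <= c -> 0 <= m ->
  (forall s, 0 <= N s) ->
  (forall s, 0 < s <= T -> is_derive N s (N' s) /\ N' s <= c * N s + m) ->
  (forall eps, 0 < eps -> exists delta, 0 < delta /\ forall s, 0 < s < delta -> N s <= B + eps) ->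
  forall t, 0 < t <= T -> N t <= exp (c * t) * (B + m).
Proof.
  intros hc hm hN hd hB t ht. apply Rnot_lt_le. intros hlt.
  set (eps := exp (- c * t) * N t - (B + m)).
  assert (hee : exp (- c * t) * exp (c * t) = 1).
  { rewrite <- exp_plus. replace (- c * t + c * t) with 0 by ring. apply exp_0. }
  assert (heps : 0 < eps).
  { unfold eps. pose proof (exp_pos (- c * t)).
    apply Rmult_lt_compat_l with (r := exp (- c * t)) in hlt; [|assumption].
    rewrite <- Rmult_assoc, hee in hlt. lra. }
  destruct (hB (eps / 2)) as (d & hd1 & hd2); [lra|].
  set (s := Rmin (d / 2) (t / 2)).
  assert (hs : 0 < s) by (apply Rmin_glb_lt; lra).
  pose proof (Rmin_l (d / 2) (t / 2)). pose proof (Rmin_r (d / 2) (t / 2)). fold s in H, H0.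
  specialize (hd2 s ltac:(lra)).
  set (y := fun r => exp (- c * r) * (N r + m)).
  set (y' := fun r => - c * exp (- c * r) * (N r + m) + exp (- c * r) * (N' r + 0)).
  assert (hy : forall r, s <= r <= t -> is_derive y r (y' r)).
  { intros r hr. unfold y, y'.
    apply (is_derive_mult (fun r => exp (- c * r)) (fun r => N r + m)).
    - auto_derive; [exact I|ring].
    - apply (is_derive_plus N (fun _ => m)); [apply hd; lra|].
      exact (@is_derive_const R_AbsRing R_NormedModule m r).
    - intros u v. apply Rmult_comm. }
  destruct (MVT_gen y s t y') as (r & hr & e).
  - intros r hr. rewrite Rmin_left, Rmax_right in hr by lra. apply hy. lra.
  - intros r hr. rewrite Rmin_left, Rmax_right in hr by lra.
    apply continuity_pt_filterlim, (ex_derive_continuous y). eexists. apply hy. lra.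
  - rewrite Rmin_left, Rmax_right in hr by lra.
    assert (y' r <= 0).
    { unfold y'. destruct (hd r) as [_ k]; [lra|]. pose proof (exp_pos (- c * r)).
      replace (- c * exp (- c * r) * (N r + m) + exp (- c * r) * (N' r + 0))
        with (exp (- c * r) * (N' r - c * N r - c * m)) by ring.
      assert (N' r - c * N r - c * m <= 0) by nra. nra. }
    assert (y t <= y s) by nra. unfold y in H2.
    assert (exp (- c * s) <= 1).
    { rewrite <- exp_0. left. apply exp_increasing. nra. }
    assert (exp (- c * s) * (N s + m) <= N s + m).
    { specialize (hN s). pose proof (exp_pos (- c * s)). nra. }
    assert (exp (- c * t) * m >= 0) by (apply Rle_ge, Rmult_le_pos; [left; apply exp_pos|lra]).
    unfold eps in *. lra.
Qed.

(** The derivative of [|e|^2] is [2 rip F e - 2 rip h e], at most [|F|^2 + |e|^2 + 2 kappa |e|^2].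
    This is the origin of the rate [1 + 2 kappa]. *)
Lemma energy_estimate {H : Hilbert} (kappa : R) (A : H -> H -> Prop)
  (e : R -> H) (e0 : H) (T M : R) :
  0 <= kappa -> quasi_accretive kappa A ->
  (forall t, 0 < t <= T -> exists h F,
    has_derivative e t (minus F h) /\ A (e t) h /\ norm F <= M) ->
  (forall eps, 0 < eps -> exists delta, 0 < delta /\
    forall t, 0 < t < delta -> norm (minus (e t) e0) < eps) ->
  forall t, 0 < t <= T -> norm (e t) ^ 2 <= exp ((1 + 2 * kappa) * t) * (norm e0 ^ 2 + M ^ 2).
Proof.
  intros hk hA he h0 t ht.
  apply gronwall with (N := fun s => norm (e s) ^ 2) (T := T)
    (N' := fun s => Derive (fun s => norm (e s) ^ 2) s).
  - lra.
  - apply pow2_ge_0.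
  - intros s. apply pow2_ge_0.
  - intros s hs. destruct (he s hs) as (h & F & h1 & h2 & h3).
    apply has_derivative_norm_sqr in h1. split.
    + apply Derive_correct. eexists. exact h1.
    + cbv beta. replace (Derive (fun s => norm (e s) ^ 2) s) with (2 * rip (minus F h) (e s))
        by (symmetry; apply is_derive_unique; exact h1).
      pose proof (graph_accretive _ _ hA _ _ h2). rip_expand.
      pose proof (rip_le_norm F (e s)). pose proof (hnorm_ge_0 F).
      pose proof (pow2_ge_0 (norm F - norm (e s))).
      assert (norm F ^ 2 <= M ^ 2) by (apply pow_incr; split; assumption). nra.
  - intros eps heps. pose proof (hnorm_ge_0 e0) as n0.
    (* Chosen so that [(|e0| + eta)^2 <= |e0|^2 + eps], using [eta <= 1] for the square of [eta]. *)
    set (eta := Rmin 1 (eps / (2 * norm e0 + 1))).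
    assert (heta : 0 < eta).
    { apply Rmin_glb_lt; [lra|]. apply Rdiv_lt_0_compat; lra. }
    assert (heta1 : eta <= 1) by apply Rmin_l.
    assert (heta2 : eta * (2 * norm e0 + 1) <= eps).
    { apply Rle_trans with (eps / (2 * norm e0 + 1) * (2 * norm e0 + 1)).
      - apply Rmult_le_compat_r; [lra|apply Rmin_r].
      - right. field. lra. }
    destruct (h0 eta heta) as (d & hd & k). exists d. split; [assumption|].
    intros s hs. specialize (k s hs).
    assert (norm (e s) <= norm e0 + eta).
    { replace (e s) with (plus e0 (minus (e s) e0)) by vec.
      eapply Rle_trans; [exact (hnorm_triangle _ _)|]. lra. }
    pose proof (hnorm_ge_0 (e s)).
    assert (norm (e s) ^ 2 <= (norm e0 + eta) ^ 2) by (apply pow_incr; split; assumption).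
    nra.
  - assumption.
Qed.

(** * Regularity, kernel and growth of a generated semigroup *)

Section GeneratedSemigroup.

Context {H : Hilbert} (A : H -> H -> Prop) (S : R -> H -> H).
Hypothesis S_sg : degenerate_semigroup S.
Hypothesis S_gen : neg_generator A S.

Lemma semigroup_weak_derivative_opp x h z t :
  A x h -> 0 < t ->
  is_derive (fun s => rip (S s x) z) t (rip (scal (RtoC (-1)) (S t h)) z).
Proof.
  intros hx ht. rip_expand. replace (-1 * rip (S t h) z) with (- rip (S t h) z) by ring.
  apply (semigroup_weak_derivative A S S_sg S_gen x h z hx). assumption.
Qed.

(** The weak derivative [- S s h] is norm continuous in [s], so the mean value inequality upgrades
    it to a norm derivative. *)
Lemma semigroup_derivative x h t :
  A x h -> 0 < t -> has_derivative (fun s => S s x) t (scal (RtoC (-1)) (S t h)).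
Proof.
  intros hx ht eps he.
  destruct (semigroup_continuous _ S_sg h t ht _ (locally_norm_lt (S t h) eps he)) as [d hd].
  exists (Rmin d t). split; [apply Rmin_glb_lt; [apply cond_pos|assumption]|].
  intros s hs. pose proof (Rmin_l d t). pose proof (Rmin_r d t).
  apply Rabs_def2 in hs.
  assert (hmin : t - Rmin d t < Rmin t s) by (apply Rmin_glb_lt; [pose proof (cond_pos d)|]; lra).
  assert (hmax : Rmax t s < t + Rmin d t) by (apply Rmax_lub_lt; [pose proof (cond_pos d)|]; lra).
  apply (weak_increment (fun s => S s x) (fun s => scal (RtoC (-1)) (S s h)) t s).
  - intros r z hr. apply semigroup_weak_derivative_opp; [assumption|]. lra.
  - intros r hr.
    apply (norm_le_eq (scal (RtoC (-1)) (minus (S r h) (S t h)))); [|vec].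
    rewrite norm_rscal_m1. left.
    apply (hd r). change (Rabs (r - t) < d). apply Rabs_def1; lra.
Qed.

(** Boundedness near [0] makes the orbit Lipschitz with constant [c]. In the estimate of
    [S t x - S s x], tested against [z = S t x - x], letting [s] tend to [0] weakly gives
    [|S t x - x| <= c t]. *)
Lemma semigroup_start x h :
  A x h -> forall eps, 0 < eps -> exists delta, 0 < delta /\
    forall t, 0 < t < delta -> norm (minus (S t x) x) < eps.
Proof.
  intros hx eps he. destruct (semigroup_bounded_near_0 _ S_sg) as [M hM].
  set (c := Rabs M * norm h).
  assert (hc : 0 <= c) by (apply Rmult_le_pos; [apply Rabs_pos|apply hnorm_ge_0]).
  exists (Rmin 1 (eps / (c + 1))).
  split; [apply Rmin_glb_lt; [lra|apply Rdiv_lt_0_compat; lra]|].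
  intros t ht. pose proof (Rmin_l 1 (eps / (c + 1))). pose proof (Rmin_r 1 (eps / (c + 1))).
  apply Rle_lt_trans with (c * t).
  - apply norm_le_of_sqr; [apply Rmult_le_pos; lra|]. apply Rnot_lt_le. intros hlt.
    set (z := minus (S t x) x) in *.
    destruct (proj2 (semigroup_weak_derivative A S S_sg S_gen x h z hx)
      (rip z z - c * t * norm z)) as (d & hd & k); [lra|].
    set (s := Rmin (d / 2) (t / 2)).
    assert (hs : 0 < s) by (apply Rmin_glb_lt; lra).
    pose proof (Rmin_l (d / 2) (t / 2)). pose proof (Rmin_r (d / 2) (t / 2)).
    fold s in H2, H3.
    specialize (k s ltac:(lra)). apply Rabs_def2 in k.
    assert (lip : norm (minus (S t x) (S s x)) <= c * Rabs (t - s)).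
    { apply (weak_lipschitz (fun s => S s x) (fun s => scal (RtoC (-1)) (S s h))).
      - intros r w hr. rewrite Rmin_left in hr by lra.
        apply semigroup_weak_derivative_opp; [assumption|]. lra.
      - intros r hr. rewrite Rmin_left, Rmax_right in hr by lra.
        rewrite norm_rscal_m1.
        eapply Rle_trans; [apply hM; lra|]. unfold c.
        apply Rmult_le_compat_r; [apply hnorm_ge_0|apply Rle_abs]. }
    rewrite Rabs_right in lip by lra.
    pose proof (rip_le_norm (minus (S t x) (S s x)) z) as k2.
    assert (e : rip z z = rip (minus (S t x) (S s x)) z + (rip (S s x) z - rip x z)).
    { unfold z at 1. rip_expand. ring. }
    pose proof (hnorm_ge_0 z).
    assert (norm (minus (S t x) (S s x)) * norm z <= c * t * norm z).
    { apply Rmult_le_compat_r; [assumption|]. nra. }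
    lra.
  - apply Rle_lt_trans with ((c + 1) * t); [nra|].
    apply Rlt_le_trans with ((c + 1) * (eps / (c + 1))); [apply Rmult_lt_compat_l; lra|].
    right. field. lra.
Qed.

(** The orbit of [0] is constant, while its weak derivative is [- S t q]. *)
Lemma semigroup_kernel q t : A zero q -> 0 < t -> S t q = zero.
Proof.
  intros hq ht. apply (re_ip_ext _ (inner_is_ip H)). intros z.
  destruct (semigroup_weak_derivative A S S_sg S_gen zero q z hq) as [hd _].
  specialize (hd t ht). rip_expand.
  assert (hd' : is_derive (fun s => rip (S s zero) z) t 0).
  { apply is_derive_ext_loc with (fun _ => 0).
    - apply filter_imp with (fun s : R => 0 < s); [|exact (open_gt 0 t ht)].
      intros s hs. rewrite (linear_rzero _ (semigroup_bounded_op _ S_sg s hs)).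
      rip_expand. reflexivity.
    - exact (@is_derive_const R_AbsRing R_NormedModule 0 t). }
  apply is_derive_unique in hd. apply is_derive_unique in hd'. lra.
Qed.

Lemma generator_resolvent (l : R) :
  exists l' Q, l <= l' /\ resolvent l' A Q.
Proof.
  destruct S_gen as [omega hgen].
  destruct (hgen (Rmax (omega + 1) l)) as (Q & hQ & _).
  { pose proof (Rmax_l (omega + 1) l). lra. }
  exists (Rmax (omega + 1) l), Q. split; [apply Rmax_r|].
  apply bounded_inverse_resolvent. assumption.
Qed.

Context (kappa : R).
Hypothesis kappa_pos : 0 <= kappa.
Hypothesis hA : quasi_accretive kappa A.

(** The threshold in [neg_generator] depends on the semigroup; here it is replaced by [kappa], which
    a whole family of graphs can share. *)
Lemma generator_common_resolvent (l : R) : kappa < l -> exists Q, resolvent l A Q.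
Proof.
  intros hl. destruct (generator_resolvent l) as (l' & Q & h1 & h2).
  exact (resolvent_decrease kappa A hA l l' Q hl h1 h2).
Qed.

Lemma domain_subspace : real_subspace (fun x => exists h, A x h).
Proof.
  split.
  - destruct (generator_resolvent 0) as (l & Q & _ & hQ).
    exists zero.
    apply (relation_cast A _ _ _ _ (graph_minus kappa A hA _ _ _ _ (hQ zero) (hQ zero))); vec.
  - intros r x y [h hx] [k hy]. eexists. apply (graph_comb _ _ hA); eassumption.
Qed.

(** [Q q] lies in the domain, so [rip q (Q q) = 0]. With [l = kappa + 1], accretivity then reads
    [|Q q|^2 <= 0], and the resolvent equation becomes [(0, q)] in [A]. *)
Lemma domain_orthogonal q : (forall x, (exists h, A x h) -> rip q x = 0) -> A zero q.
Proof.
  intros hq. destruct (generator_common_resolvent (kappa + 1)) as [Q hQ]; [lra|].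
  specialize (hQ q).
  assert (hz : Q q = zero).
  { apply (re_ip_def _ (inner_is_ip H)).
    pose proof (graph_accretive _ _ hA _ _ hQ) as k. rip_expand_in k.
    rewrite (hq (Q q)), norm_sqr in k by (eexists; exact hQ).
    pose proof (re_ip_pos _ (inner_is_ip H) (Q q)). lra. }
  apply (relation_cast A _ _ _ _ hQ); [assumption|]. rewrite hz. vec.
Qed.

Lemma domain_decomposition f :
  exists p q, f = plus p q /\ limit_point (fun x => exists h, A x h) p /\ A zero q /\
    norm p <= norm f.
Proof.
  destruct (orthogonal_decomposition _ f domain_subspace) as (p & q & hf & hp & hq).
  exists p, q. split; [assumption|]. split; [assumption|].
  split; [apply domain_orthogonal; assumption|].
  assert (hpq : rip q p = 0).
  { apply Rabs_eq_0, Rle_antisym; [|apply Rabs_pos]. apply Rnot_lt_le. intros hlt.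
    pose proof (hnorm_ge_0 q).
    destruct (hp (Rabs (rip q p) / (norm q + 1))) as (x & hx & hd).
    { apply Rdiv_lt_0_compat; lra. }
    pose proof (Rabs_rip_le_norm q (minus p x)) as k. rip_expand_in k.
    rewrite (hq x hx), Rminus_0_r in k.
    apply Rmult_lt_compat_l with (r := norm q + 1) in hd; [|lra].
    replace ((norm q + 1) * (Rabs (rip q p) / (norm q + 1))) with (Rabs (rip q p))
      in hd by (field; lra).
    pose proof (hnorm_ge_0 (minus p x)). lra. }
  apply Rsqr_incr_0; [|apply hnorm_ge_0|apply hnorm_ge_0].
  rewrite !Rsqr_pow2, !norm_sqr, hf. rip_expand.
  rewrite (rip_sym p q), hpq. pose proof (re_ip_pos _ (inner_is_ip H) q). lra.
Qed.

Lemma exp_ge_1 x : 0 <= x -> 1 <= exp x.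
Proof. intros hx. pose proof (exp_ineq1_le x). lra. Qed.

(** The energy estimate without forcing. It bounds the square of the norm; since the exponential is
    at least [1], its square root may be replaced by itself. *)
Lemma semigroup_domain_bound x h t :
  A x h -> 0 < t -> norm (S t x) <= exp ((1 + 2 * kappa) * t) * norm x.
Proof.
  intros hx ht.
  assert (hE : 1 <= exp ((1 + 2 * kappa) * t)) by (apply exp_ge_1; apply Rmult_le_pos; lra).
  apply Rsqr_incr_0; [|apply hnorm_ge_0|apply Rmult_le_pos; [lra|apply hnorm_ge_0]].
  rewrite !Rsqr_pow2.
  apply Rle_trans with (exp ((1 + 2 * kappa) * t) * (norm x ^ 2 + 0 ^ 2)).
  - apply (energy_estimate kappa A (fun s => S s x) x t 0); try assumption; [| |lra].
    + intros s hs. exists (S s h), zero. repeat split.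
      * replace (minus zero (S s h)) with (scal (RtoC (-1)) (S s h)) by vec.
        apply semigroup_derivative; [assumption|lra].
      * apply (semigroup_graph A S S_sg S_gen); [assumption|lra].
      * right. exact (norm_zero (V := H)).
    + apply (semigroup_start x h hx).
  - set (E := exp _) in *. pose proof (pow2_ge_0 (norm x)).
    replace ((E * norm x) ^ 2) with (E * (E * norm x ^ 2)) by ring.
    apply Rmult_le_compat_l; [lra|]. nra.
Qed.

(** The kernel part of [f] is killed and the rest is approximated from the domain. The operator norm
    of the single [S t] serves only this approximation, so the resulting constant depends on [kappa]
    and [t] alone. *)
Lemma semigroup_bound f t :
  0 < t -> norm (S t f) <= exp ((1 + 2 * kappa) * t) * norm f.
Proof.
  intros ht. destruct (domain_decomposition f) as (p & q & hf & hp & hq & hn).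
  pose proof (semigroup_bounded_op _ S_sg t ht) as hlin.
  set (E := exp ((1 + 2 * kappa) * t)).
  assert (hE : 1 <= E) by (apply exp_ge_1; apply Rmult_le_pos; lra).
  apply Rle_trans with (E * norm p); [|apply Rmult_le_compat_l; lra].
  assert (e : S t f = S t p).
  { rewrite hf, (linear_plus _ hlin), (semigroup_kernel q t hq ht). vec. }
  rewrite e. destruct (linear_norm _ hlin) as (M & hM & hb).
  apply Rnot_lt_le. intros hlt.
  (* Replacing [p] by [x] costs [M |p - x|] under [S t] and [E |p - x|] in the bound. *)
  destruct (hp ((norm (S t p) - E * norm p) / (E + M + 1))) as (x & [h hx] & hd).
  { apply Rdiv_lt_0_compat; lra. }
  apply Rmult_lt_compat_l with (r := E + M + 1) in hd; [|lra].
  replace ((E + M + 1) * ((norm (S t p) - E * norm p) / (E + M + 1)))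
    with (norm (S t p) - E * norm p) in hd by (field; lra).
  pose proof (semigroup_domain_bound x h t hx ht) as k1. fold E in k1.
  pose proof (hb (minus p x)) as k2.
  assert (k3 : norm (S t p) <= norm (S t x) + norm (S t (minus p x))).
  { rewrite (bounded_linear_minus _ hlin).
    replace (S t p) with (plus (S t x) (minus (S t p) (S t x))) at 1 by vec.
    exact (hnorm_triangle _ _). }
  assert (k4 : norm x <= norm p + norm (minus p x)).
  { replace x with (minus p (minus p x)) at 1 by vec. exact (norm_minus_le _ _). }
  pose proof (hnorm_ge_0 (minus p x)). nra.
Qed.

Lemma semigroup_lipschitz x h T s t :
  A x h -> 0 < s <= T -> 0 < t <= T ->
  norm (minus (S t x) (S s x)) <= exp ((1 + 2 * kappa) * T) * norm h * Rabs (t - s).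
Proof.
  intros hx hs ht.
  apply (weak_lipschitz (fun s => S s x) (fun s => scal (RtoC (-1)) (S s h))).
  - intros r z hr. apply semigroup_weak_derivative_opp; [assumption|].
    apply Rlt_le_trans with (Rmin s t); [apply Rmin_glb_lt; lra|apply hr].
  - intros r hr.
    assert (0 < r) by (apply Rlt_le_trans with (Rmin s t); [apply Rmin_glb_lt; lra|apply hr]).
    assert (r <= T) by (apply Rle_trans with (Rmax s t); [apply hr|apply Rmax_lub; lra]).
    rewrite norm_rscal_m1.
    eapply Rle_trans; [apply semigroup_bound; assumption|].
    apply Rmult_le_compat_r; [apply hnorm_ge_0|].
    destruct (Req_dec r T) as [->|hrT]; [lra|].
    left. apply exp_increasing. apply Rmult_lt_compat_l; lra.
Qed.

End GeneratedSemigroup.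

(** * Convergence of semigroups from convergence of resolvents *)

(** Pointwise smallness at finitely many nodes of mesh [eta] is spread by the common Lipschitz
    constant, with [L eta <= eps / 2]; the induction adds one mesh interval at a time. *)
Lemma uniform_of_lipschitz (G : nat -> R -> R) (T L : R) :
  0 <= L ->
  (forall n s t, 0 < s <= T -> 0 < t <= T -> G n t <= G n s + L * Rabs (t - s)) ->
  (forall t, 0 < t <= T -> forall eps, 0 < eps ->
    exists N, forall n, (N <= n)%nat -> G n t < eps) ->
  forall eps, 0 < eps -> exists N, forall n, (N <= n)%nat ->
    forall t, 0 < t <= T -> G n t < eps.
Proof.
  intros hL hlip hpt eps he.
  set (eta := eps / 2 / (L + 1)).
  assert (heta : 0 < eta) by (apply Rdiv_lt_0_compat; lra).
  assert (hLe : L * eta <= eps / 2).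
  { replace (eps / 2) with ((L + 1) * eta) by (unfold eta; field; lra). nra. }
  assert (key : forall k : nat, exists N, forall n, (N <= n)%nat ->
    forall t, 0 < t <= T -> t <= INR k * eta -> G n t < eps).
  { induction k as [|k [N hN]].
    - exists 0%nat. intros n _ t ht ht'. simpl in ht'. lra.
    - destruct (Rle_lt_dec T 0) as [hT|hT].
      { exists 0%nat. intros n _ t ht. lra. }
      rewrite S_INR. pose proof (pos_INR k).
      (* The right endpoint serves as node, because [0] itself is excluded. *)
      set (tau := Rmin T ((INR k + 1) * eta)).
      assert (htau : 0 < tau) by (apply Rmin_glb_lt; [assumption|apply Rmult_lt_0_compat; lra]).
      pose proof (Rmin_l T ((INR k + 1) * eta)). pose proof (Rmin_r T ((INR k + 1) * eta)).
      fold tau in H0, H1.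
      destruct (hpt tau ltac:(lra) (eps / 2)) as [N' hN']; [lra|].
      exists (Nat.max N N'). intros n hn t ht ht'.
      destruct (Rle_lt_dec t (INR k * eta)) as [hk|hk]; [apply hN; auto; lia|].
      specialize (hN' n ltac:(lia)). specialize (hlip n tau t ltac:(lra) ht).
      assert (t <= tau) by (apply Rmin_glb; lra).
      rewrite Rabs_left1 in hlip by lra.
      assert (L * - (t - tau) <= L * eta) by (apply Rmult_le_compat_l; lra). lra. }
  destruct (nfloor_ex (Rmax T 0 / eta)) as [k hk].
  { apply Rdiv_le_0_compat; [apply Rmax_r|assumption]. }
  destruct (key (Datatypes.S k)) as [N hN]. exists N. intros n hn t ht. apply hN; auto.
  rewrite S_INR. pose proof (Rmax_l T 0).
  apply Rle_trans with (Rmax T 0 / eta * eta); [|apply Rmult_le_compat_r; lra].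
  replace (Rmax T 0 / eta * eta) with (Rmax T 0) by (field; lra). lra.
Qed.

Section Resolvent.

Context {H : Hilbert} (kappa l : R) (A : H -> H -> Prop) (Q : H -> H).
Hypothesis hA : quasi_accretive kappa A.
Hypothesis hl : kappa + 1 <= l.
Hypothesis hQ : resolvent l A Q.

(** The requirement [kappa + 1 <= l] is made for this bound, which frees the later estimates of
    resolvent constants. *)
Lemma resolvent_contraction f : norm (Q f) <= norm f.
Proof.
  eapply Rle_trans; [apply (resolvent_norm kappa A hA l Q f); [lra|assumption]|].
  apply Rmult_le_reg_r with (l - kappa); [lra|].
  replace (norm f / (l - kappa) * (l - kappa)) with (norm f) by (field; lra).
  pose proof (hnorm_ge_0 f). nra.
Qed.

Lemma resolvent_minus_contraction f g : norm (minus (Q f) (Q g)) <= norm (minus f g).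
Proof.
  rewrite <- (resolvent_minus kappa A hA l Q) by (assumption || lra).
  apply resolvent_contraction.
Qed.

Lemma resolvent_kernel q : A zero q -> Q q = zero.
Proof.
  intros hq. symmetry. etransitivity.
  { apply (resolvent_of_graph kappa A hA l Q zero q); [lra|assumption|assumption]. }
  f_equal. vec.
Qed.

Variable S : R -> H -> H.
Hypothesis S_sg : degenerate_semigroup S.
Hypothesis S_gen : neg_generator A S.

(** The common [l] may lie outside the half-line of the Laplace formula, so commutation is derived
    from invariance of the graph and uniqueness. *)
Lemma semigroup_resolvent_comm t f : 0 < t -> S t (Q f) = Q (S t f).
Proof.
  intros ht. pose proof (semigroup_bounded_op _ S_sg t ht) as hlin.
  apply (resolvent_eq kappa A hA l) with (f := S t f); [lra| |apply hQ].
  apply (relation_cast A _ _ _ _ (semigroup_graph A S S_sg S_gen _ _ t (hQ f) ht)); [reflexivity|].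
  rewrite (bounded_linear_minus _ hlin), (linear_scal _ hlin). reflexivity.
Qed.

Hypothesis kappa_pos : 0 <= kappa.

Lemma resolvent_domain_approx y delta :
  0 < delta -> exists m h, A m h /\ norm (minus (Q y) (Q m)) < delta.
Proof.
  intros hd.
  destruct (domain_decomposition A S S_gen kappa hA y)
    as (p & q & hy & hp & hq & _).
  destruct (hp delta hd) as (m & [h hm] & hdm). exists m, h. split; [assumption|].
  rewrite hy, (resolvent_plus kappa A hA l Q) by (assumption || lra).
  rewrite (resolvent_kernel q hq).
  eapply Rle_lt_trans; [|exact hdm].
  apply (norm_le_eq (minus (Q p) (Q m))); [apply resolvent_minus_contraction|vec].
Qed.

(** Domain elements have the form [Q y], and [y] may be replaced by a domain element since [Q] kills
    its orthogonal part. Doing so twice, [p] is near [Q y1], near [Q m1 = Q (Q y2)], near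
    [Q (Q m2)], with [delta / 3] for each step. *)
Lemma resolvent_square_dense p delta :
  limit_point (fun x => exists h, A x h) p -> 0 < delta ->
  exists m h, A m h /\ norm (minus p (Q (Q m))) < delta.
Proof.
  intros hp hd.
  destruct (hp (delta / 3)) as (x & [k hx] & h1); [lra|].
  rewrite (resolvent_of_graph kappa A hA l Q x k) in h1 by (assumption || lra).
  set (y1 := plus k (scal (RtoC l) x)) in *.
  destruct (resolvent_domain_approx y1 (delta / 3)) as (m1 & k1 & hm1 & h2); [lra|].
  pose proof (resolvent_of_graph kappa A hA l Q m1 k1 ltac:(lra) hQ hm1) as e.
  set (y2 := plus k1 (scal (RtoC l) m1)) in *.
  destruct (resolvent_domain_approx y2 (delta / 3)) as (m2 & k2 & hm2 & h3); [lra|].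
  exists m2, k2. split; [assumption|].
  pose proof (norm_minus_triangle p (Q y1) (Q (Q m2))).
  pose proof (norm_minus_triangle (Q y1) (Q m1) (Q (Q m2))).
  pose proof (resolvent_minus_contraction m1 (Q m2)) as h4.
  rewrite <- e in h3. lra.
Qed.

End Resolvent.

(** * The defect of the approximating semigroups and its estimate *)

Section TrotterKato.

Context {H : Hilbert} (kappa l T : R).
Context (A : H -> H -> Prop) (S : R -> H -> H) (Q : H -> H).
Context (An : nat -> H -> H -> Prop) (Sn : nat -> R -> H -> H) (Qn : nat -> H -> H).
Hypothesis kappa_pos : 0 <= kappa.
Hypothesis hl : kappa + 1 <= l.
Hypothesis T_pos : 0 < T.
Hypothesis hA : quasi_accretive kappa A.
Hypothesis hAn : forall n, quasi_accretive kappa (An n).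
Hypothesis S_sg : degenerate_semigroup S.
Hypothesis S_gen : neg_generator A S.
Hypothesis Sn_sg : forall n, degenerate_semigroup (Sn n).
Hypothesis Sn_gen : forall n, neg_generator (An n) (Sn n).
Hypothesis hQ : resolvent l A Q.
Hypothesis hQn : forall n, resolvent l (An n) (Qn n).
Hypothesis Qn_lim : forall f eps, 0 < eps -> exists N, forall n, (N <= n)%nat ->
  norm (minus (Qn n f) (Q f)) < eps.
Hypothesis kernel : forall n q, A zero q -> An n zero q.

Let E := exp ((1 + 2 * kappa) * T).

Lemma growth_ge_1 : 1 <= E.
Proof. apply exp_ge_1. apply Rmult_le_pos; lra. Qed.

Lemma growth_le t : 0 < t <= T -> exp ((1 + 2 * kappa) * t) <= E.
Proof.
  intros ht. destruct (Req_dec t T) as [->|htT]; [right; reflexivity|].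
  left. apply exp_increasing. apply Rmult_lt_compat_l; lra.
Qed.

Lemma semigroup_growth f t : 0 < t <= T -> norm (S t f) <= E * norm f.
Proof.
  intros ht. eapply Rle_trans;
    [apply (semigroup_bound A S S_sg S_gen kappa kappa_pos hA); lra|].
  apply Rmult_le_compat_r; [apply hnorm_ge_0|apply growth_le; assumption].
Qed.

Lemma semigroup_seq_growth n f t : 0 < t <= T -> norm (Sn n t f) <= E * norm f.
Proof.
  intros ht. eapply Rle_trans;
    [apply (semigroup_bound (An n) (Sn n) (Sn_sg n) (Sn_gen n) kappa kappa_pos (hAn n)); lra|].
  apply Rmult_le_compat_r; [apply hnorm_ge_0|apply growth_le; assumption].
Qed.

(** At fixed [t] this is strong resolvent convergence at the vector [S t m]. The Lipschitz constant
    counts the orbit's constant [E |h|] once for [Qn n] and once for [Q], both contractions. *)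
Lemma resolvent_orbit_uniform m h eps :
  A m h -> 0 < eps -> exists N, forall n, (N <= n)%nat ->
    forall t, 0 < t <= T -> norm (minus (Qn n (S t m)) (Q (S t m))) < eps.
Proof.
  intros hm he.
  apply (uniform_of_lipschitz (fun n t => norm (minus (Qn n (S t m)) (Q (S t m)))) T
    (2 * (E * norm h))).
  - pose proof (hnorm_ge_0 h). pose proof growth_ge_1.
    apply Rmult_le_pos; [lra|apply Rmult_le_pos; lra].
  - intros n s t hs ht.
    pose proof (semigroup_lipschitz A S S_sg S_gen kappa kappa_pos hA m h T s t hm hs ht) as k.
    fold E in k.
    pose proof (resolvent_minus_contraction kappa l (An n) (Qn n) (hAn n) hl (hQn n)
      (S t m) (S s m)) as k1.
    pose proof (resolvent_minus_contraction kappa l A Q hA hl hQ (S t m) (S s m)) as k2.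
    pose proof (norm_minus_triangle (Qn n (S t m)) (Qn n (S s m)) (Q (S t m))) as k3.
    pose proof (norm_minus_triangle (Qn n (S s m)) (Q (S s m)) (Q (S t m))) as k4.
    rewrite (norm_minus_sym (Q (S s m))) in k4. lra.
  - intros t ht e' he'. apply Qn_lim. assumption.
  - assumption.
Qed.

(* [e t = Sn_t Qn k - Qn S_t k], with [k = Q m], solves
   [e' + An e = (Qn - Q) S_t m] with [e 0 = 0]. *)
Lemma defect_estimate n m M :
  (forall t, 0 < t <= T -> norm (minus (Qn n (S t m)) (Q (S t m))) <= M) ->
  forall t, 0 < t <= T ->
    norm (minus (Sn n t (Qn n (Q m))) (Qn n (S t (Q m)))) <= E * M.
Proof.
  intros hM t ht. set (k := Q m) in *.
  assert (hM0 : 0 <= M) by exact (Rle_trans _ _ _ (hnorm_ge_0 _) (hM t ht)).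
  pose proof growth_ge_1 as hE.
  set (e := fun s => minus (Sn n s (Qn n k)) (Qn n (S s k))).
  assert (hk : A k (minus m (scal (RtoC l) k))) by apply hQ.
  pose proof (hQn n k) as hnk.
  assert (est : norm (e t) ^ 2 <= exp ((1 + 2 * kappa) * t) * (norm (zero : H) ^ 2 + M ^ 2)).
  { apply (energy_estimate kappa (An n) e zero T M); [assumption|apply hAn| | |assumption].
    - intros s hs.
      set (h1 := Sn n s (minus k (scal (RtoC l) (Qn n k)))).
      set (h2 := minus (S s k) (scal (RtoC l) (Qn n (S s k)))).
      (* The derivative of the defect is [- h1 + Qn S_s m - l Qn S_s k]. Adding and subtracting
         [S_s k = Q S_s m] completes the last term to [h2] and leaves the stated forcing. *)
      exists (minus h1 h2), (minus (Qn n (S s m)) (Q (S s m))).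
      split; [|split].
      + assert (d1 : has_derivative (fun r => Sn n r (Qn n k)) s (scal (RtoC (-1)) h1))
          by (apply (semigroup_derivative (An n)); auto; lra).
        assert (d2 : has_derivative (fun r => Qn n (S r k)) s
          (Qn n (scal (RtoC (-1)) (S s (minus m (scal (RtoC l) k)))))).
        { apply (has_derivative_map (Qn n) 1); [lra| | | |].
          - intros x y. apply (resolvent_minus kappa (An n) (hAn n) l); [lra|apply hQn].
          - intros r x. apply (resolvent_scal kappa (An n) (hAn n) l); [lra|apply hQn].
          - intros x. rewrite Rmult_1_l.
            apply (resolvent_contraction kappa l (An n) (Qn n)); auto.
          - apply (semigroup_derivative A); auto; lra. }
        pose proof (has_derivative_minus _ _ _ _ _ d1 d2) as d.
        refine (eq_ind _ (has_derivative e s) d _ _).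
        pose proof (semigroup_bounded_op _ S_sg s (proj1 hs)) as hlin.
        rewrite (resolvent_scal kappa (An n) (hAn n) l) by (auto; lra).
        rewrite (bounded_linear_minus _ hlin), (linear_scal _ hlin).
        rewrite (resolvent_minus kappa (An n) (hAn n) l) by (auto; lra).
        rewrite (resolvent_scal kappa (An n) (hAn n) l l (Qn n)) by (auto; lra).
        rewrite <- (semigroup_resolvent_comm kappa l A Q hA hl hQ S S_sg S_gen s m) by lra.
        fold k. unfold h2. vec.
      + apply (graph_minus kappa (An n) (hAn n)); [|apply hQn].
        apply (semigroup_graph (An n) (Sn n)); auto; lra.
      + apply hM. assumption.
    - intros eps heps.
      destruct (semigroup_start (An n) (Sn n) (Sn_sg n) (Sn_gen n) _ _ hnk (eps / 2))
        as (d & hd & h1); [lra|].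
      destruct (semigroup_start A S S_sg S_gen _ _ hk (eps / 2)) as (d' & hd' & h1'); [lra|].
      exists (Rmin d d'). split; [apply Rmin_glb_lt; assumption|]. intros s hs.
      pose proof (Rmin_l d d'). pose proof (Rmin_r d d').
      specialize (h1 s ltac:(lra)). specialize (h1' s ltac:(lra)).
      pose proof (resolvent_minus_contraction kappa l (An n) (Qn n) (hAn n) hl (hQn n) (S s k) k).
      apply Rle_lt_trans with (norm (minus (Sn n s (Qn n k)) (Qn n k))
        + norm (minus (Qn n (S s k)) (Qn n k))); [|lra].
      eapply norm_le_eq; [apply (norm_minus_le (minus (Sn n s (Qn n k)) (Qn n k))
        (minus (Qn n (S s k)) (Qn n k)))|].
      unfold e. vec. }
  replace (norm (zero : H)) with 0 in est by (symmetry; exact (norm_zero (V := H))).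
  pose proof (growth_le t ht) as hg.
  change (norm (e t) <= E * M).
  apply Rsqr_incr_0; [|apply hnorm_ge_0|apply Rmult_le_pos; lra].
  rewrite !Rsqr_pow2. eapply Rle_trans; [exact est|].
  pose proof (pow2_ge_0 M).
  apply Rle_trans with (E * M ^ 2); [rewrite pow_i by lia; nra|].
  replace ((E * M) ^ 2) with (E * (E * M ^ 2)) by ring.
  apply Rmult_le_compat_l; [lra|nra].
Qed.

(** With [k = Q m], the difference splits into [Sn (Q k - Qn k)], the defect, and [(Qn - Q) S_t k],
    of size at most [E eta], [E eta] and [eta]; hence [eta = eps / (2 E + 1)]. *)
Lemma trotter_kato_core m h eps :
  A m h -> 0 < eps -> exists N, forall n, (N <= n)%nat -> forall t, 0 < t <= T ->
    norm (minus (Sn n t (Q (Q m))) (S t (Q (Q m)))) < eps.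
Proof.
  intros hm he. pose proof growth_ge_1 as hE.
  set (eta := eps / (2 * E + 1)).
  assert (heta : 0 < eta) by (apply Rdiv_lt_0_compat; lra).
  set (k := Q m).
  destruct (resolvent_orbit_uniform m h eta hm heta) as [N1 hN1].
  destruct (resolvent_orbit_uniform k _ eta (hQ m) heta) as [N2 hN2].
  destruct (Qn_lim k eta heta) as [N3 hN3].
  exists (Nat.max N1 (Nat.max N2 N3)). intros n hn t ht.
  specialize (hN3 n ltac:(lia)). specialize (hN2 n ltac:(lia) t ht).
  pose proof (defect_estimate n m eta) as k1.
  specialize (k1 (fun s hs => Rlt_le _ _ (hN1 n ltac:(lia) s hs)) t ht). fold k in k1.
  rewrite (semigroup_resolvent_comm kappa l A Q hA hl hQ S S_sg S_gen t k) by lra.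
  pose proof (norm_minus_triangle (Sn n t (Q k)) (Sn n t (Qn n k)) (Q (S t k))) as k2.
  pose proof (norm_minus_triangle (Sn n t (Qn n k)) (Qn n (S t k)) (Q (S t k))) as k3.
  pose proof (semigroup_seq_growth n (minus (Q k) (Qn n k)) t ht) as k4.
  rewrite (bounded_linear_minus _ (semigroup_bounded_op _ (Sn_sg n) t (proj1 ht))),
    (norm_minus_sym (Q k)) in k4.
  assert (E * norm (minus (Qn n k) (Q k)) <= E * eta) by (apply Rmult_le_compat_l; lra).
  assert (eps = (2 * E + 1) * eta) by (unfold eta; field; lra). lra.
Qed.

(** The kernel part of [f] is annihilated by both semigroups at every positive time. For the rest,
    the uniform growth bound [E] is paid once for each semigroup when [p] is replaced by
    [Q (Q m)]. *)
Theorem trotter_kato f eps :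
  0 < eps -> exists N, forall n, (N <= n)%nat -> forall t, 0 < t <= T ->
    norm (minus (Sn n t f) (S t f)) < eps.
Proof.
  intros he. pose proof growth_ge_1 as hE.
  destruct (domain_decomposition A S S_gen kappa hA f)
    as (p & q & hf & hp & hq & _).
  set (eta := eps / (2 * E + 1)).
  assert (heta : 0 < eta) by (apply Rdiv_lt_0_compat; lra).
  destruct (resolvent_square_dense kappa l A Q hA hl hQ S S_gen p eta hp heta)
    as (m & h & hm & hpm).
  destruct (trotter_kato_core m h eta hm heta) as [N hN].
  exists N. intros n hn t ht. specialize (hN n hn t ht).
  pose proof (semigroup_bounded_op _ S_sg t (proj1 ht)) as hlin.
  pose proof (semigroup_bounded_op _ (Sn_sg n) t (proj1 ht)) as hlinn.
  rewrite hf, (linear_plus _ hlin), (linear_plus _ hlinn).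
  rewrite (semigroup_kernel A S S_sg S_gen q t hq (proj1 ht)).
  rewrite (semigroup_kernel (An n) (Sn n) (Sn_sg n) (Sn_gen n) q t (kernel n q hq) (proj1 ht)).
  apply Rle_lt_trans with (norm (minus (Sn n t p) (S t p))).
  { apply (norm_le_eq (minus (Sn n t p) (S t p))); [right; reflexivity|vec]. }
  set (x := Q (Q m)) in *.
  pose proof (norm_minus_triangle (Sn n t p) (Sn n t x) (S t p)) as k1.
  pose proof (norm_minus_triangle (Sn n t x) (S t x) (S t p)) as k2.
  rewrite (norm_minus_sym (S t x)) in k2.
  pose proof (semigroup_growth (minus p x) t ht) as k3.
  pose proof (semigroup_seq_growth n (minus p x) t ht) as k4.
  rewrite (bounded_linear_minus _ hlin) in k3. rewrite (bounded_linear_minus _ hlinn) in k4.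
  assert (E * norm (minus p x) <= E * eta) by (apply Rmult_le_compat_l; lra).
  assert (eps = (2 * E + 1) * eta) by (unfold eta; field; lra). lra.
Qed.

End TrotterKato.

(** * Comparison of complete norms *)

Lemma pow_half_lt eps : 0 < eps -> exists N, forall n, (N <= n)%nat -> (1 / 2) ^ n < eps.
Proof.
  intros he. destruct (pow_lt_1_zero (1 / 2)) with (y := eps) as [N hN].
  - rewrite Rabs_right; lra.
  - assumption.
  - exists N. intros n hn. eapply Rle_lt_trans; [apply Rle_abs|apply hN; assumption].
Qed.

(** Baire's argument for the sublevel sets of [p], which cover [V]. If none were dense in a ball,
    nested closed balls missing them one after another would shrink to a point where [p] exceeds
    every integer. *)
Lemma baire_sublevel {V : Hilbert} (p : V -> R) :
  exists (k : nat) (x : V) (r : R), 0 < r /\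
    forall y, norm (minus y x) < r -> forall eps, 0 < eps ->
      exists w, p w <= INR k /\ norm (minus y w) < eps.
Proof.
  apply NNPP. intros hno.
  assert (step : forall (k : nat) (c : V * R), exists c' : V * R, 0 < snd c ->
    0 < snd c' <= snd c / 2 /\ norm (minus (fst c') (fst c)) + snd c' <= snd c /\
    forall w, norm (minus (fst c') w) <= snd c' -> INR k < p w).
  { intros k [x r]. simpl.
    destruct (Rle_lt_dec r 0) as [hr|hr]; [exists (x, r); intros; lra|].
    apply NNPP. intros hno'. apply hno. exists k, x, r. split; [assumption|].
    intros y hy eps he. apply NNPP. intros hno''. apply hno'.
    (* The three entries make the new closed ball miss the sublevel set, stay inside the old ball,
       and have at most half its radius. *)
    set (s := Rmin (eps / 2) (Rmin ((r - norm (minus y x)) / 2) (r / 2))).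
    assert (0 < s) by (repeat apply Rmin_glb_lt; lra).
    assert (s <= eps / 2) by apply Rmin_l.
    assert (s <= (r - norm (minus y x)) / 2)
      by exact (Rle_trans _ _ _ (Rmin_r _ _) (Rmin_l _ _)).
    assert (s <= r / 2) by exact (Rle_trans _ _ _ (Rmin_r _ _) (Rmin_r _ _)).
    exists (y, s). intros _. simpl. split; [lra|]. split; [lra|].
    intros w hw. apply Rnot_le_lt. intros hpw. apply hno''. exists w. split; [assumption|lra]. }
  set (next := fun k c => proj1_sig (constructive_indefinite_description _ (step k c))).
  assert (hnext : forall k c, 0 < snd c ->
    0 < snd (next k c) <= snd c / 2 /\
    norm (minus (fst (next k c)) (fst c)) + snd (next k c) <= snd c /\
    forall w, norm (minus (fst (next k c)) w) <= snd (next k c) -> INR k < p w).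
  { intros k c. exact (proj2_sig (constructive_indefinite_description _ (step k c))). }
  clearbody next.
  set (c := fix c n := match n with O => (zero : V, 1) | Datatypes.S n => next n (c n) end).
  assert (hr : forall n, 0 < snd (c n) <= (1 / 2) ^ n).
  { induction n as [|n IH]; simpl; [lra|].
    pose proof (proj1 (hnext n (c n) ltac:(lra))). simpl in *. lra. }
  assert (hnest : forall n m, norm (minus (fst (c (n + m)%nat)) (fst (c n))) + snd (c (n + m)%nat)
    <= snd (c n)).
  { intros n. induction m as [|m IH].
    - rewrite Nat.add_0_r. rewrite (norm_eq_rscal 0 (fst (c n))) by vec. rewrite Rabs_R0. lra.
    - rewrite Nat.add_succ_r.
      change (c (Datatypes.S (n + m))) with (next (n + m)%nat (c (n + m)%nat)).
      destruct (hnext (n + m)%nat (c (n + m)%nat) (proj1 (hr _))) as (_ & k & _).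
      pose proof (norm_minus_triangle (fst (next (n + m)%nat (c (n + m)%nat)))
        (fst (c (n + m)%nat)) (fst (c n))). lra. }
  assert (hnear : forall n m, (n <= m)%nat -> norm (minus (fst (c m)) (fst (c n))) <= snd (c n)).
  { intros n m hnm. pose proof (hnest n (m - n)%nat) as k.
    replace (n + (m - n))%nat with m in k by lia. pose proof (proj1 (hr m)). lra. }
  destruct (hilbert_complete (fun n => fst (c n))) as [x hx].
  { intros eps he. destruct (pow_half_lt (eps / 2)) as [N hN]; [lra|]. exists N.
    intros n m hn hm. pose proof (norm_minus_triangle (fst (c n)) (fst (c N)) (fst (c m))) as k.
    rewrite (norm_minus_sym (fst (c N))) in k.
    pose proof (hnear N n hn). pose proof (hnear N m hm).
    pose proof (hr N). specialize (hN N (Nat.le_refl N)). lra. }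
  assert (hlim : forall n, norm (minus (fst (c n)) x) <= snd (c n)).
  { intros n. apply Rnot_lt_le. intros hlt.
    destruct (hx (norm (minus (fst (c n)) x) - snd (c n))) as [N hN]; [lra|].
    specialize (hN (Nat.max n N) ltac:(lia)).
    pose proof (hnear n (Nat.max n N) ltac:(lia)) as k. rewrite norm_minus_sym in k.
    pose proof (norm_minus_triangle (fst (c n)) (fst (c (Nat.max n N))) x). lra. }
  assert (hp : forall k : nat, INR k < p x).
  { intros k. destruct (hnext k (c k) (proj1 (hr k))) as (_ & _ & h).
    apply h. apply (hlim (Datatypes.S k)). }
  destruct (nfloor_ex (Rmax (p x) 0) (Rmax_r _ _)) as [k hk].
  specialize (hp (Datatypes.S k)). rewrite S_INR in hp. pose proof (Rmax_l (p x) 0). lra.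
Qed.

(** * Closed graph argument for two complete norms controlling [norm (j u)] *)

Section DominatedNorm.

Context {V H : Hilbert} (j : V -> H) (p : V -> R) (M : R).
Hypothesis j_lin : is_linear j.
Hypothesis j_inj : forall u v, j u = j v -> u = v.
Hypothesis p_ge0 : forall u, 0 <= p u.
Hypothesis p_plus : forall u v, p (plus u v) <= p u + p v.
Hypothesis p_scal : forall r u, p (scal (RtoC r) u) = Rabs r * p u.
Hypothesis p_complete : forall u : nat -> V,
  (forall eps, 0 < eps -> exists N, forall n m, (N <= n)%nat -> (N <= m)%nat ->
     p (minus (u n) (u m)) < eps) ->
  exists l, forall eps, 0 < eps -> exists N, forall n, (N <= n)%nat -> p (minus (u n) l) < eps.
Hypothesis p_dom : forall u, norm (j u) <= M * p u.

Lemma p_cast u v : u = v -> p u = p v.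
Proof. intros ->. reflexivity. Qed.

Lemma p_minus_triangle u v w : p (minus u w) <= p (minus u v) + p (minus v w).
Proof.
  rewrite (p_cast (minus u w) (plus (minus u v) (minus v w))) by vec.
  exact (p_plus _ _).
Qed.

Lemma p_minus_sym u v : p (minus u v) = p (minus v u).
Proof.
  rewrite (p_cast (minus u v) (scal (RtoC (-1)) (minus v u))) by vec.
  rewrite p_scal, Rabs_left; lra.
Qed.

(** The ball from Baire's argument is recentred by subtracting approximants of [x + s y] and of [x],
    then rescaled by [s = r / rho]. The difference has [p] at most [2 k]; the added [1] keeps [c]
    positive when [k = 0]. *)
Lemma sublevel_scaled : exists c, 0 < c /\ forall rho y, 0 < rho -> norm y < rho ->
  forall eps, 0 < eps -> exists w, p w <= c * rho /\ norm (minus y w) < eps.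
Proof.
  destruct (baire_sublevel p) as (k & x & r & hr & h).
  pose proof (pos_INR k) as hk.
  exists ((2 * INR k + 1) / r). split; [apply Rdiv_lt_0_compat; lra|].
  intros rho y hrho hy eps he.
  set (s := r / rho). assert (hs : 0 < s) by (apply Rdiv_lt_0_compat; assumption).
  assert (hseps : 0 < s * eps / 2) by (apply Rdiv_lt_0_compat; [apply Rmult_lt_0_compat|]; lra).
  destruct (h (plus x (scal (RtoC s) y))) with (eps := s * eps / 2) as (w1 & h1 & h1').
  { rewrite (norm_eq_rscal s y) by vec. rewrite Rabs_right by lra.
    replace r with (s * rho) by (unfold s; field; lra). apply Rmult_lt_compat_l; lra. }
  { assumption. }
  destruct (h x) with (eps := s * eps / 2) as (w2 & h2 & h2').
  { rewrite (norm_eq_rscal 0 x) by vec. rewrite Rabs_R0. lra. }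
  { assumption. }
  exists (scal (RtoC (/ s)) (minus w1 w2)).
  assert (his : 0 < / s) by (apply Rinv_0_lt_compat; assumption).
  split.
  - rewrite p_scal, Rabs_right by lra.
    replace ((2 * INR k + 1) / r * rho) with (/ s * (2 * INR k + 1))
      by (unfold s; field; lra).
    apply Rmult_le_compat_l; [lra|].
    pose proof (p_minus_triangle w1 zero w2) as t.
    rewrite (p_minus_sym zero w2), (p_cast (minus w1 zero) w1),
      (p_cast (minus w2 zero) w2) in t by vec.
    lra.
  - rewrite (norm_eq_rscal (/ s) (minus (minus (plus x (scal (RtoC s) y)) w1) (minus x w2))).
    + rewrite Rabs_right by lra.
      apply Rmult_lt_reg_l with s; [assumption|].
      rewrite <- Rmult_assoc, Rinv_r, Rmult_1_l by lra.
      eapply Rle_lt_trans; [exact (norm_minus_le _ _)|]. lra.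
    + vec. lra.
Qed.

(** Successive approximation, as in the open mapping theorem: [u] is exhausted by corrections with
    [p] at most [c / 2^n], leaving remainders [y n] of norm below [1 / 2^n]. Completeness of [p]
    provides a limit of the partial sums [u - y n], and the corrections sum to [2 c]. *)
Lemma dominated_unit_ball : exists c, 0 < c /\ forall u, norm u < 1 -> p u <= c.
Proof.
  destruct sublevel_scaled as (c & hc & h).
  exists (2 * c). split; [lra|]. intros u hu.
  assert (hstep : forall (n : nat) (y : V), exists w, norm y < (1 / 2) ^ n ->
    p w <= c * (1 / 2) ^ n /\ norm (minus y w) < (1 / 2) ^ Datatypes.S n).
  { intros n y.
    assert (hp : forall n, 0 < (1 / 2) ^ n) by (intros; apply pow_lt; lra).
    destruct (Rle_lt_dec ((1 / 2) ^ n) (norm y)) as [hy|hy]; [exists zero; intros; lra|].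
    destruct (h ((1 / 2) ^ n) y (hp n) hy _ (hp (Datatypes.S n))) as [w hw].
    exists w. intros _. exact hw. }
  set (W := fun n y => proj1_sig (constructive_indefinite_description _ (hstep n y))).
  assert (hW : forall n y, norm y < (1 / 2) ^ n ->
    p (W n y) <= c * (1 / 2) ^ n /\ norm (minus y (W n y)) < (1 / 2) ^ Datatypes.S n).
  { intros n y. exact (proj2_sig (constructive_indefinite_description _ (hstep n y))). }
  clearbody W.
  set (y := fix y (n : nat) : V :=
    match n with O => u | Datatypes.S n => minus (y n) (W n (y n)) end).
  assert (hy : forall n, norm (y n) < (1 / 2) ^ n).
  { induction n as [|n IH]; [simpl; assumption|]. exact (proj2 (hW n _ IH)). }
  assert (hd : forall n m, p (minus (y n) (y (n + m)%nat)) <=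
    2 * c * (1 / 2) ^ n - 2 * c * (1 / 2) ^ (n + m)).
  { intros n. induction m as [|m IH].
    - rewrite Nat.add_0_r, (p_cast _ (scal (RtoC 0) (y n))) by vec. rewrite p_scal, Rabs_R0. lra.
    - rewrite Nat.add_succ_r.
      pose proof (p_minus_triangle (y n) (y (n + m)%nat) (y (Datatypes.S (n + m)))) as t.
      rewrite (p_cast (minus (y (n + m)%nat) (y (Datatypes.S (n + m))))
        (W (n + m)%nat (y (n + m)%nat))) in t
        by (simpl; vec).
      pose proof (proj1 (hW _ _ (hy (n + m)%nat))).
      change ((1 / 2) ^ Datatypes.S (n + m)) with (1 / 2 * (1 / 2) ^ (n + m)). lra. }
  assert (hp : forall n, 0 < (1 / 2) ^ n) by (intros; apply pow_lt; lra).
  destruct (p_complete (fun n => minus u (y n))) as [l hl].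
  { intros eps he. destruct (pow_half_lt (eps / (4 * c))) as [N hN]; [apply Rdiv_lt_0_compat; lra|].
    exists N. intros n m hn hm.
    rewrite (p_cast _ (minus (y m) (y n))) by vec.
    pose proof (p_minus_triangle (y m) (y N) (y n)) as t.
    rewrite (p_minus_sym (y m) (y N)) in t.
    pose proof (hd N (n - N)%nat) as k1. pose proof (hd N (m - N)%nat) as k2.
    replace (N + (n - N))%nat with n in k1 by lia. replace (N + (m - N))%nat with m in k2 by lia.
    specialize (hN N (Nat.le_refl N)). apply Rmult_lt_compat_l with (r := 4 * c) in hN; [|lra].
    replace (4 * c * (eps / (4 * c))) with eps in hN by (field; lra).
    pose proof (Rmult_lt_0_compat _ _ hc (hp n)).
    pose proof (Rmult_lt_0_compat _ _ hc (hp m)). lra. }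
  destruct (linear_norm _ j_lin) as (Mj & hMj & hj).
  assert (hM : forall v, norm (j v) <= (Rabs M + 1) * p v).
  { intros v. eapply Rle_trans; [apply p_dom|]. apply Rmult_le_compat_r; [apply p_ge0|].
    pose proof (Rle_abs M). lra. }
  pose proof (Rabs_pos M) as hM0.
  assert (hlu : l = u).
  (* The [p]-limit [l] and the norm limit [u] of the partial sums coincide, because both norms
     control the norm of the image under [j], where limits are unique. *)
  { apply j_inj, norm_minus_eq0. apply Rle_antisym; [|apply hnorm_ge_0].
    apply Rnot_lt_le. intros hlt. set (d := norm (minus (j l) (j u))) in *.
    destruct (hl (d / 2 / (Rabs M + 1))) as [N1 hN1]; [apply Rdiv_lt_0_compat; lra|].
    destruct (pow_half_lt (d / 2 / Mj)) as [N2 hN2]; [apply Rdiv_lt_0_compat; lra|].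
    set (n := Nat.max N1 N2). specialize (hN1 n ltac:(lia)). specialize (hN2 n ltac:(lia)).
    apply Rmult_lt_compat_l with (r := Rabs M + 1) in hN1; [|lra].
    replace ((Rabs M + 1) * (d / 2 / (Rabs M + 1))) with (d / 2) in hN1 by (field; lra).
    pose proof (Rlt_trans _ _ _ (hy n) hN2) as hyn.
    apply Rmult_lt_compat_l with (r := Mj) in hyn; [|lra].
    replace (Mj * (d / 2 / Mj)) with (d / 2) in hyn by (field; lra).
    pose proof (hM (minus (minus u (y n)) l)) as k1. pose proof (hj (y n)) as k2.
    pose proof (Rle_lt_trans _ _ _ k1 hN1) as k3. pose proof (Rle_lt_trans _ _ _ k2 hyn) as k4.
    assert (d <= norm (j (minus (minus u (y n)) l)) + norm (j (y n))); [|lra].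
    unfold d. apply (norm_le_eq (scal (RtoC (-1)) (plus (j (minus (minus u (y n)) l)) (j (y n))))).
    - rewrite norm_rscal_m1. exact (hnorm_triangle _ _).
    - rewrite !(bounded_linear_minus _ j_lin). vec. }
  subst l. apply Rnot_lt_le. intros hlt.
  destruct (hl (p u - 2 * c)) as [N hN]; [lra|]. specialize (hN N (Nat.le_refl N)).
  assert (k : p (minus u (y N)) <= 2 * c - 2 * c * (1 / 2) ^ N).
  { pose proof (hd 0%nat N) as k. rewrite Nat.add_0_l, pow_O in k.
    eapply Rle_trans; [exact k|lra]. }
  rewrite (p_cast _ (scal (RtoC (-1)) (y N))) in hN by vec.
  rewrite p_scal, Rabs_left in hN by lra.
  assert (t : p u <= p (minus u (y N)) + p (y N)).
  { eapply Rle_trans; [right; apply (p_cast u (plus (minus u (y N)) (y N))); vec|].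
    exact (p_plus _ _). }
  pose proof (Rmult_lt_0_compat _ _ hc (hp N)). lra.
Qed.

Lemma dominated_norm : exists c, 0 < c /\ forall u, p u <= c * norm u.
Proof.
  destruct dominated_unit_ball as (c & hc & h). exists (2 * c). split; [lra|].
  intros u. pose proof (hnorm_ge_0 u). destruct (Req_dec (norm u) 0) as [e|e].
  - rewrite (p_cast u (scal (RtoC 0) u)).
    + rewrite p_scal, Rabs_R0. apply Rle_trans with 0; [lra|].
      apply Rmult_le_pos; lra.
    + rewrite (norm_eq_zero (V := V) u e). vec.
  (* Scaling to norm [1 / 2], since the bound is known only on the open unit ball. *)
  - set (s := / (2 * norm u)).
    assert (hs : 0 < s) by (apply Rinv_0_lt_compat; lra).
    assert (hsu : s * norm u = 1 / 2) by (unfold s; field; assumption).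
    pose proof (h (scal (RtoC s) u)) as k.
    rewrite norm_rscal, p_scal, Rabs_right, hsu in k by lra.
    specialize (k ltac:(lra)).
    apply Rmult_le_reg_l with s; [assumption|].
    replace (s * (2 * c * norm u)) with (2 * c * (s * norm u)) by ring. rewrite hsu. lra.
Qed.

End DominatedNorm.

(** * Sectorial forms *)

(** In polar form the inequality says that [sin (theta - phi)] and [sin (theta + phi)] are
    nonnegative. It is a closed condition, so it survives passing to the closure. *)
Lemma adherent_sector (theta : R) (z : C) :
  0 < theta < PI / 2 -> adherent (sector theta) z ->
  0 <= fst z /\ cos theta * Rabs (snd z) <= sin theta * fst z.
Proof.
  intros ht hz.
  pose proof PI_RGT_0 as hpi.
  assert (hcos : 0 < cos theta) by (apply cos_gt_0; lra).
  assert (hsin : 0 < sin theta) by (apply sin_gt_0; lra).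
  assert (hsec : forall w, sector theta w ->
    0 <= fst w /\ cos theta * Rabs (snd w) <= sin theta * fst w).
  { intros w (r & phi & hr & hphi & ->). simpl. apply Rabs_def2 in hphi.
    assert (hc : 0 < cos phi) by (apply cos_gt_0; lra).
    assert (h1 : 0 < sin (theta - phi)) by (apply sin_gt_0; lra).
    assert (h2 : 0 < sin (theta + phi)) by (apply sin_gt_0; lra).
    rewrite sin_minus in h1. rewrite sin_plus in h2.
    split; [apply Rmult_le_pos; lra|].
    rewrite Rabs_mult, (Rabs_right r) by lra.
    assert (cos theta * Rabs (sin phi) <= sin theta * cos phi).
    { unfold Rabs. destruct (Rcase_abs (sin phi)); lra. }
    nra. }
  assert (happ : forall eps, 0 < eps -> exists w, sector theta w /\
    Rabs (fst w - fst z) < eps /\ Rabs (snd w - snd z) < eps).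
  { intros eps he.
    destruct (hz (fun w => Rabs (fst w - fst z) < eps /\ Rabs (snd w - snd z) < eps))
      as (w & hw & hs).
    - exists (mkposreal eps he). intros w [h1 h2]. split; [exact h1|exact h2].
    - exists w. tauto. }
  split; apply Rnot_lt_le; intros hlt.
  - destruct (happ (- fst z)) as (w & hw & h1 & _); [lra|].
    apply hsec in hw. apply Rabs_def2 in h1. lra.
  - set (d := cos theta * Rabs (snd z) - sin theta * fst z).
    (* An error of this size in both coordinates changes the two sides by less than the supposed
       violation [d] in total. *)
    destruct (happ (d / (cos theta + sin theta))) as (w & hw & h1 & h2).
    { apply Rdiv_lt_0_compat; unfold d; lra. }
    apply hsec in hw. destruct hw as [_ hw].
    set (e := d / (cos theta + sin theta)) in *.
    assert (he : cos theta * e + sin theta * e = d) by (unfold e; field; lra).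
    pose proof (Rabs_triang_inv (snd z) (snd w)) as k.
    rewrite (Rabs_minus_sym (snd z)) in k. apply Rabs_def2 in h1.
    assert (cos theta * (Rabs (snd z) - Rabs (snd w)) < cos theta * e)
      by (apply Rmult_lt_compat_l; lra).
    assert (sin theta * (fst w - fst z) < sin theta * e)
      by (apply Rmult_lt_compat_l; lra).
    unfold d in *. lra.
Qed.

(** * Bounded coercive forms and Cea's lemma *)

Section BoundedForm.

Context {V : ModuleSpace C_AbsRing} (ip b : V -> V -> C) (c : R).
Hypothesis ip_ok : is_inner_product ip.
Hypothesis b_sesqui : sesquilinear b.
Hypothesis b_re : forall w, Rabs (fst (b w w)) <= c * re_ip ip w w.
Hypothesis b_im : forall w, Rabs (snd (b w w)) <= c * re_ip ip w w.

(* Polarization: [Re b(u,v)] is the difference of the symmetric part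
   [(Re b(u+v) - Re b(u-v)) / 4] and the skew part [(Im b(u+iv) - Im b(u-iv)) / 4]. *)
Lemma form_polarization_bound u v :
  fst (b u v) <= c * (re_ip ip u u + re_ip ip v v).
Proof.
  set (w := scal (Ci : C) v).
  assert (hw : re_ip ip w w = re_ip ip v v).
  { unfold re_ip, w. rewrite (sesqui_scal_l _ (ip_sesqui _ ip_ok)),
      (sesqui_scal_r _ (ip_sesqui _ ip_ok)).
    unfold Cmult, Cconj, Ci. simpl. ring. }
  assert (hm : forall x y, b x (scal (RtoC (-1)) y) = Copp (b x y)).
  { intros x y. rewrite (sesqui_scal_r _ b_sesqui). unfold Cmult, Cconj, Copp, RtoC.
    simpl. f_equal; ring. }
  assert (hm' : forall x y, b (scal (RtoC (-1)) x) y = Copp (b x y)).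
  { intros x y. rewrite (sesqui_scal_l _ b_sesqui). unfold Cmult, Copp, RtoC.
    simpl. f_equal; ring. }
  assert (hx : forall x y, b (plus x y) (plus x y) =
    Cplus (Cplus (b x x) (b x y)) (Cplus (b y x) (b y y))).
  { intros x y. rewrite (sesqui_plus_l _ b_sesqui), !(sesqui_plus_r _ b_sesqui). reflexivity. }
  assert (hq : forall y, re_ip ip (plus u y) (plus u y) +
    re_ip ip (plus u (scal (RtoC (-1)) y)) (plus u (scal (RtoC (-1)) y)) =
    2 * re_ip ip u u + 2 * re_ip ip y y).
  { intros y. ip_expand ip_ok. ring. }
  pose proof (hq v) as q1. pose proof (hq w) as q2. rewrite hw in q2.
  pose proof (b_re (plus u v)) as k1.
  pose proof (b_re (plus u (scal (RtoC (-1)) v))) as k2.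
  pose proof (b_im (plus u w)) as k3.
  pose proof (b_im (plus u (scal (RtoC (-1)) w))) as k4.
  rewrite hx in k1, k2, k3, k4. rewrite !hm, !hm', ?hm in k2. rewrite !hm, !hm', ?hm in k4.
  assert (e1 : b u w = Cmult (Cconj Ci) (b u v)) by apply (sesqui_scal_r _ b_sesqui).
  assert (e2 : b w u = Cmult Ci (b v u)) by apply (sesqui_scal_l _ b_sesqui).
  rewrite e1, e2 in k3, k4.
  apply Rabs_le_between in k1. apply Rabs_le_between in k2.
  apply Rabs_le_between in k3. apply Rabs_le_between in k4.
  unfold Cmult, Cconj, Ci, Copp, Cplus in k1, k2, k3, k4. simpl in k1, k2, k3, k4.
  set (n1 := re_ip ip (plus u v) (plus u v)) in *.
  set (n2 := re_ip ip (plus u (scal (RtoC (-1)) v)) (plus u (scal (RtoC (-1)) v))) in *.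
  set (n3 := re_ip ip (plus u w) (plus u w)) in *.
  set (n4 := re_ip ip (plus u (scal (RtoC (-1)) w)) (plus u (scal (RtoC (-1)) w))) in *.
  (* By the parallelogram law the four quadratic bounds add up to [4 c (|u|^2 + |v|^2)], and
     polarization divides by [4]. *)
  assert (e5 : c * n1 + c * n2 = c * (2 * re_ip ip u u + 2 * re_ip ip v v))
    by (rewrite <- q1; ring).
  assert (e6 : c * n3 + c * n4 = c * (2 * re_ip ip u u + 2 * re_ip ip v v))
    by (rewrite <- q2; ring).
  lra.
Qed.

Hypothesis c_pos : 0 < c.
Hypothesis b_coercive : forall w, re_ip ip w w <= fst (b w w).

(** Here [e] is the Galerkin error and [d] the error of a competitor; the hypothesis is Galerkin
    orthogonality. The weight [2 c] on [d] yields [2 |e|^2 <= |e|^2 + 4 c^2 |d|^2], so that [|e|^2]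
    is absorbed. *)
Lemma cea (e d : V) : fst (b e e) = fst (b e d) ->
  ip_norm ip e <= 2 * c * ip_norm ip d.
Proof.
  intros h.
  pose proof (form_polarization_bound e (scal (RtoC (2 * c)) d)) as k.
  rewrite (sesqui_scal_r _ b_sesqui) in k. ip_expand_in ip_ok k.
  assert (e1 : fst (Cmult (Cconj (RtoC (2 * c))) (b e d)) = 2 * c * fst (b e d))
    by (unfold Cmult, Cconj, RtoC; simpl; ring).
  rewrite e1, <- h in k. pose proof (b_coercive e) as k2.
  apply Rsqr_incr_0; [|apply ip_norm_ge0|apply Rmult_le_pos; [lra|apply ip_norm_ge0]].
  rewrite !Rsqr_pow2, Rpow_mult_distr, !ip_norm_sqr by assumption.
  assert (2 * re_ip ip e e <= re_ip ip e e + 2 * c * (2 * c * re_ip ip d d)).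
  { apply Rmult_le_reg_l with c; [assumption|].
    assert (c * (2 * re_ip ip e e) <= c * (2 * fst (b e e))) by (apply Rmult_le_compat_l; lra).
    lra. }
  lra.
Qed.

End BoundedForm.

(** * Graphs of restricted forms and Galerkin approximation *)

Section FormGraph.

Context {V H : Hilbert} (j : V -> H) (a : V -> V -> C).
Hypothesis j_lin : is_linear j.
Hypothesis a_sesqui : sesquilinear a.

(** Testing the defining identity with [v = u] gives [rip h x] as the real part of [a u u]. The
    resulting constant does not see [D], whence a rate common to all [An]. *)
Lemma form_graph_quasi_accretive (gamma : R) (D : V -> Prop) :
  linear_subspace D ->
  (forall u, gamma * norm (j u) ^ 2 <= fst (a u u)) ->
  quasi_accretive (Rabs gamma) (form_graph j a D).
Proof.
  intros hD ha. split.
  - intros r x h y k (u & hu & -> & hu') (w & hw & -> & hw').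
    exists (plus u (scal (RtoC r) w)). split; [|split].
    + apply (subspace_plus _ hD); [assumption|]. apply (subspace_scal _ hD). assumption.
    + rewrite (linear_plus _ j_lin), (linear_scal _ j_lin). reflexivity.
    + intros v hv.
      rewrite (sesqui_plus_l _ a_sesqui), (sesqui_scal_l _ a_sesqui), hu', hw' by assumption.
      pose proof (ip_sesqui _ (inner_is_ip H)) as hi.
      rewrite (sesqui_plus_l _ hi), (sesqui_scal_l _ hi). reflexivity.
  - intros x h (u & hu & -> & hu'). unfold re_ip. rewrite <- hu' by assumption.
    eapply Rle_trans; [|apply ha]. apply Rmult_le_compat_r; [apply pow2_ge_0|].
    pose proof (Rabs_maj2 gamma). lra.
Qed.

Lemma form_graph_kernel (D : V -> Prop) q :
  (forall u v : V, j u = j v -> u = v) -> linear_subspace D ->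
  form_graph j a (fun _ => True) zero q -> form_graph j a D zero q.
Proof.
  intros j_inj hD (u & _ & hu & ha). exists u. split; [|split].
  - replace u with (zero : V); [apply hD|].
    apply j_inj. rewrite <- hu. apply linear_rzero. assumption.
  - assumption.
  - intros v _. apply ha. exact I.
Qed.

Lemma re_form_inner omega u :
  re_ip (form_inner j a omega) u u = fst (a u u) + omega * norm (j u) ^ 2.
Proof.
  rewrite norm_sqr. unfold re_ip, form_inner, real_form, Cplus, Cmult, Cconj, RtoC.
  simpl. field.
Qed.

Definition shifted_form (l : R) (u v : V) : C :=
  Cplus (a u v) (Cmult (RtoC l) (inner (j u) (j v))).

Lemma shifted_form_sesqui l : sesquilinear (shifted_form l).
Proof.
  pose proof (ip_sesqui _ (inner_is_ip H)) as hi.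
  split; intros; unfold shifted_form;
    rewrite ?(linear_plus _ j_lin), ?(linear_scal _ j_lin).
  - rewrite (sesqui_plus_l _ a_sesqui), (sesqui_plus_l _ hi).
    apply injective_projections; unfold Cplus, Cmult, RtoC; simpl; ring.
  - rewrite (sesqui_scal_l _ a_sesqui), (sesqui_scal_l _ hi).
    apply injective_projections; unfold Cplus, Cmult, RtoC; simpl; ring.
  - rewrite (sesqui_plus_r _ a_sesqui), (sesqui_plus_r _ hi).
    apply injective_projections; unfold Cplus, Cmult, RtoC; simpl; ring.
  - rewrite (sesqui_scal_r _ a_sesqui), (sesqui_scal_r _ hi).
    apply injective_projections; unfold Cplus, Cmult, RtoC; simpl; ring.
Qed.

Lemma shifted_form_re l u v : fst (shifted_form l u v) = fst (a u v) + l * rip (j u) (j v).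
Proof. unfold shifted_form, re_ip, Cplus, Cmult, RtoC. simpl. ring. Qed.

Lemma shifted_form_im l u : snd (shifted_form l u u) = snd (a u u).
Proof.
  assert (e : snd (inner (j u) (j u)) = 0).
  { pose proof (f_equal snd (ip_herm _ (inner_is_ip H) (j u) (j u))) as k.
    unfold Cconj in k. simpl in k. lra. }
  unfold shifted_form, Cplus, Cmult, RtoC. simpl. rewrite e. ring.
Qed.

Lemma form_graph_solution l (D : V -> Prop) Q f :
  resolvent l (form_graph j a D) Q ->
  exists u, D u /\ Q f = j u /\ forall v, D v -> fst (shifted_form l u v) = rip f (j v).
Proof.
  intros hQ. destruct (hQ f) as (u & hu & e & hv). exists u.
  split; [assumption|]. split; [assumption|]. intros v hDv.
  rewrite shifted_form_re, hv by assumption. rewrite e.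
  change (fst (inner (minus f (scal (RtoC l) (j u))) (j v)))
    with (rip (minus f (scal (RtoC l) (j u))) (j v)).
  rip_expand. ring.
Qed.

Hypothesis j_inj : forall u v : V, j u = j v -> u = v.

(** [Q f] and [Qn n f] are images under [j] of the solution [u] and of its Galerkin approximation
    [un] in [Vn n]. Cea's lemma compares [u - un] with [u - v], where [v] comes from density in the
    norm of [V]; [dominated_norm] passes from that norm to the form norm. *)
Lemma galerkin_convergence (omega l c M : R) (Vn : nat -> V -> Prop)
  (Q : H -> H) (Qn : nat -> H -> H) :
  is_inner_product (form_inner j a omega) ->
  ip_complete (form_inner j a omega) ->
  (forall u, norm (j u) <= M * ip_norm (form_inner j a omega) u) ->
  0 < c -> omega <= l ->
  (forall w, Rabs (fst (shifted_form l w w)) <= c * re_ip (form_inner j a omega) w w) ->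
  (forall w, Rabs (snd (shifted_form l w w)) <= c * re_ip (form_inner j a omega) w w) ->
  (forall (n m : nat) (u : V), (n <= m)%nat -> Vn n u -> Vn m u) ->
  dense (fun u : V => exists n : nat, Vn n u) ->
  resolvent l (form_graph j a (fun _ => True)) Q ->
  (forall n, resolvent l (form_graph j a (Vn n)) (Qn n)) ->
  forall f eps, 0 < eps -> exists N, forall n, (N <= n)%nat ->
    norm (minus (Qn n f) (Q f)) < eps.
Proof.
  intros hip hcomp hM hc hl hre him hincr hdense hQ hQn f eps he.
  set (ip := form_inner j a omega) in *.
  destruct (dominated_norm j (ip_norm ip) M j_lin j_inj (ip_norm_ge0 ip)
    (ip_norm_triangle ip hip) (ip_norm_scal ip hip)) as (C0 & hC & hCb).
  { intros u hu. destruct (hcomp u) as [w hw].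
    - intros e. apply hu, cond_pos.
    - exists w. intros e hepos. apply is_lim_seq_spec in hw.
      destruct (hw (mkposreal e hepos)) as [N hN]. exists N. intros n hn.
      specialize (hN n hn). simpl in hN. rewrite Rminus_0_r in hN.
      eapply Rle_lt_trans; [apply Rle_abs|exact hN]. }
  { exact hM. }
  destruct (form_graph_solution l _ Q f hQ) as (u & _ & eu & hu).
  (* Three factors: from the form norm to [H], from Cea's lemma, and from the norm of [V] to the
     form norm. *)
  set (B := (Rabs M + 1) * (2 * c) * C0).
  assert (hB : 0 < B).
  { unfold B. pose proof (Rabs_pos M). repeat apply Rmult_lt_0_compat; lra. }
  destruct (dense_norm _ u (eps / B) hdense) as (v & [N hv] & huv).
  { apply Rdiv_lt_0_compat; assumption. }
  exists N. intros n hn.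
  destruct (form_graph_solution l _ (Qn n) f (hQn n)) as (un & hun & eun & hunv).
  rewrite eu, eun, norm_minus_sym, <- (bounded_linear_minus _ j_lin).
  set (b := shifted_form l). pose proof (shifted_form_sesqui l : sesquilinear b) as hb.
  assert (hbm : forall x y w, fst (b (minus x y) w) = fst (b x w) - fst (b y w)).
  { intros x y w. assert (e : fst (b (plus (minus x y) y) w) = fst (b (minus x y) w) + fst (b y w))
      by (rewrite (sesqui_plus_l _ hb); reflexivity).
    replace (plus (minus x y) y) with x in e by vec. lra. }
  assert (hbm' : forall x y w, fst (b w (minus x y)) = fst (b w x) - fst (b w y)).
  { intros x y w. assert (e : fst (b w (plus (minus x y) y)) = fst (b w (minus x y)) + fst (b w y))
      by (rewrite (sesqui_plus_r _ hb); reflexivity).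
    replace (plus (minus x y) y) with x in e by vec. lra. }
  (* [un] and [v] both lie in [Vn n], the latter because [N <= n], and the error is [b]-orthogonal
     to that space. *)
  assert (horth : fst (b (minus u un) (minus u un)) = fst (b (minus u un) (minus u v))).
  { assert (h0 : forall w, Vn n w -> fst (b (minus u un) w) = 0).
    { intros w hw. rewrite hbm. unfold b. rewrite (hu w I), (hunv w hw). ring. }
    rewrite !hbm', (h0 un hun), (h0 v (hincr N n v hn hv)). reflexivity. }
  pose proof (cea ip b c hip hb hre him hc) as k.
  assert (hcoer : forall w, re_ip ip w w <= fst (b w w)).
  { intros w. unfold b, ip. rewrite shifted_form_re, re_form_inner, <- norm_sqr.
    pose proof (pow2_ge_0 (norm (j w))). nra. }
  specialize (k hcoer _ _ horth).
  pose proof (hCb (minus u v)) as k2. pose proof (hM (minus u un)) as k3.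
  pose proof (Rabs_pos M) as k4. pose proof (Rle_abs M) as k5.
  pose proof (ip_norm_ge0 ip (minus u un)) as k6.
  apply Rmult_lt_compat_l with (r := B) in huv; [|assumption].
  replace (B * (eps / B)) with eps in huv by (field; lra).
  eapply Rle_lt_trans; [|exact huv]. unfold B.
  apply Rle_trans with ((Rabs M + 1) * ip_norm ip (minus u un)); [nra|].
  apply Rle_trans with ((Rabs M + 1) * (2 * c * (C0 * norm (minus u v)))); [|right; ring].
  apply Rmult_le_compat_l; [lra|]. eapply Rle_trans; [exact k|].
  apply Rmult_le_compat_l; [lra|exact k2].
Qed.

End FormGraph.

Lemma sectorial_numerical_range {V H : Hilbert} (j : V -> H) (a : V -> V -> C) :
  sectorial_form j a -> exists gamma c, 0 < c /\ forall u,
    gamma * norm (j u) ^ 2 <= fst (a u u) /\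
    Rabs (snd (a u u)) <= c * (fst (a u u) - gamma * norm (j u) ^ 2).
Proof.
  intros (theta & gamma & ht & hs). exists gamma, (tan theta).
  pose proof PI_RGT_0 as hpi.
  assert (hcos : 0 < cos theta) by (apply cos_gt_0; lra).
  split; [apply tan_gt_0; lra|]. intros u.
  destruct (adherent_sector theta _ ht (hs u)) as [h1 h2].
  unfold Cminus, Cplus, Copp, RtoC in h1, h2. simpl in h1, h2.
  rewrite Ropp_0, Rplus_0_r in h2. split; [simpl; lra|].
  apply Rmult_le_reg_l with (cos theta); [assumption|].
  eapply Rle_trans; [exact h2|]. right. unfold tan. simpl. field. lra.
Qed.

Theorem theorem3p7 (V H : Hilbert)
  (j : V -> H) (j_cont : is_linear j)
  (j_inj : forall u v : V, j u = j v -> u = v)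
  (a : V -> V -> C) (a_sesqui : sesquilinear a)
  (a_sect : sectorial_form j a) (a_closed : closed_form j a)
  (A : H -> H -> Prop) (A_def : A = form_graph j a (fun _ : V => True))
  (Vn : nat -> V -> Prop)
  (Vn_sub : forall n : nat, linear_subspace (Vn n))
  (Vn_closed : forall n : nat, closed (Vn n))
  (Vn_incr : forall (n m : nat) (u : V), (n <= m)%nat -> Vn n u -> Vn m u)
  (Vn_dense : dense (fun u : V => exists n : nat, Vn n u))
  (An : nat -> H -> H -> Prop)
  (An_def : forall n : nat, An n = form_graph j a (Vn n))
  (S : R -> H -> H) (S_sg : degenerate_semigroup S) (S_gen : neg_generator A S)
  (Sn : nat -> R -> H -> H)
  (Sn_sg : forall n : nat, degenerate_semigroup (Sn n))
  (Sn_gen : forall n : nat, neg_generator (An n) (Sn n))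
  (T : R) (T_pos : 0 < T) (f : H) :
  exists d : nat -> R,
    (forall n : nat,
       is_lub (fun r : R => exists t : R,
                 0 < t <= T /\ r = norm (minus (Sn n t f) (S t f))) (d n)) /\
    is_lim_seq d 0.
Proof.
  destruct (sectorial_numerical_range j a a_sect) as (gamma & c & hc & hnr).
  destruct a_closed as (omega & hip & hcomp & M & hM).
  (* This [l] satisfies [kappa + 1 <= l], so resolvents are contractions, and [omega <= l], so the
     shifted form dominates the form inner product. *)
  set (kappa := Rabs gamma). set (l := kappa + Rabs omega + 1).
  set (ip := form_inner j a omega) in *.
  pose proof (Rabs_pos gamma) as hkappa. fold kappa in hkappa.
  pose proof (Rabs_pos omega) as homega0. pose proof (Rle_abs omega) as homega.
  assert (hsubT : linear_subspace (fun _ : V => True)) by (split; auto).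
  assert (hA : quasi_accretive kappa A).
  { rewrite A_def. apply form_graph_quasi_accretive; auto. apply hnr. }
  assert (hAn : forall n, quasi_accretive kappa (An n)).
  { intros n. rewrite An_def. apply form_graph_quasi_accretive; auto. apply hnr. }
  assert (hl : kappa < l) by (unfold l; lra).
  destruct (generator_common_resolvent A S S_gen kappa hA l hl) as [Q hQ].
  assert (hexn : forall n, exists Q, resolvent l (An n) Q).
  { intros n. apply (generator_common_resolvent (An n) (Sn n) (Sn_gen n) kappa (hAn n) l hl). }
  set (Qn := fun n => proj1_sig (constructive_indefinite_description _ (hexn n))).
  assert (hQn : forall n, resolvent l (An n) (Qn n)).
  { intros n. exact (proj2_sig (constructive_indefinite_description _ (hexn n))). }
  clearbody Qn.
  assert (hp : forall w, norm (j w) ^ 2 <= M ^ 2 * re_ip ip w w).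
  { intros w. rewrite <- ip_norm_sqr by assumption. rewrite <- Rpow_mult_distr.
    apply pow_incr. split; [apply hnorm_ge_0|apply hM]. }
  assert (hpr : forall w, fst (a w w) = re_ip ip w w - omega * norm (j w) ^ 2).
  { intros w. unfold ip. rewrite re_form_inner. ring. }
  assert (hpos : forall w, 0 <= re_ip ip w w) by (intros w; apply (re_ip_pos ip hip)).
  assert (hsc : forall w x, x * norm (j w) ^ 2 <= Rabs x * M ^ 2 * re_ip ip w w).
  { intros w x. rewrite Rmult_assoc.
    apply Rle_trans with (Rabs x * norm (j w) ^ 2).
    - apply Rmult_le_compat_r; [apply pow2_ge_0|apply Rle_abs].
    - apply Rmult_le_compat_l; [apply Rabs_pos|apply hp]. }
  (* [c1] bounds the real part of the shifted form, which is the squared form norm plus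
     [(l - omega) |j w|^2]. [c2] bounds the imaginary part through the sector, where the real part
     of [a w w] minus [gamma |j w|^2] is the squared form norm plus [(- omega - gamma) |j w|^2]. *)
  set (c1 := 1 + Rabs (l - omega) * M ^ 2).
  set (c2 := c * (1 + Rabs (- omega - gamma) * M ^ 2)).
  assert (hc1 : 0 < c1).
  { unfold c1. pose proof (Rmult_le_pos _ _ (Rabs_pos (l - omega)) (pow2_ge_0 M)). lra. }
  assert (hc2 : 0 < c2).
  { unfold c2. pose proof (Rmult_le_pos _ _ (Rabs_pos (- omega - gamma)) (pow2_ge_0 M)).
    apply Rmult_lt_0_compat; lra. }
  assert (hlim : forall g eps, 0 < eps -> exists N, forall n, (N <= n)%nat ->
    norm (minus (Qn n g) (Q g)) < eps).
  { apply (galerkin_convergence j a j_cont a_sesqui j_inj omega l (c1 + c2) M Vn Q Qn);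
      try assumption.
    - lra.
    - unfold l. lra.
    - intros w. rewrite shifted_form_re, <- norm_sqr, hpr. fold ip.
      assert (hs : 0 <= (l - omega) * norm (j w) ^ 2)
        by (apply Rmult_le_pos; [unfold l; lra|apply pow2_ge_0]).
      pose proof (hpos w). rewrite Rabs_right by lra.
      pose proof (hsc w (l - omega)).
      apply Rle_trans with (c1 * re_ip ip w w); [unfold c1; lra|].
      apply Rmult_le_compat_r; lra.
    - intros w. rewrite shifted_form_im. fold ip. pose proof (hpos w).
      eapply Rle_trans; [apply hnr|]. rewrite hpr.
      apply Rle_trans with (c2 * re_ip ip w w); [|apply Rmult_le_compat_r; lra].
      unfold c2. rewrite Rmult_assoc. apply Rmult_le_compat_l; [lra|].
      pose proof (hsc w (- omega - gamma)). lra.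
    - rewrite <- A_def. assumption.
    - intros n. rewrite <- An_def. apply hQn. }
  assert (hker : forall n q, A zero q -> An n zero q).
  { intros n q. rewrite A_def, An_def. apply form_graph_kernel; auto. }
  assert (hl1 : kappa + 1 <= l) by (unfold l; lra).
  set (E := exp ((1 + 2 * kappa) * T)).
  assert (hlub : forall n, {m | is_lub (fun r : R => exists t : R,
    0 < t <= T /\ r = norm (minus (Sn n t f) (S t f))) m}).
  { intros n. apply completeness.
    - exists (E * norm f + E * norm f). intros r (t & ht & ->).
      eapply Rle_trans; [exact (norm_minus_le _ _)|]. apply Rplus_le_compat.
      + apply (semigroup_seq_growth kappa T An Sn hkappa hAn Sn_sg Sn_gen n f t ht).
      + apply (semigroup_growth kappa T A S hkappa hA S_sg S_gen f t ht).
    - exists (norm (minus (Sn n T f) (S T f))), T. split; [lra|reflexivity]. }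
  exists (fun n => proj1_sig (hlub n)). split; [intros n; exact (proj2_sig (hlub n))|].
  apply is_lim_seq_spec. intros eps.
  destruct (trotter_kato kappa l T A S Q An Sn Qn hkappa hl1 T_pos hA hAn S_sg S_gen
    Sn_sg Sn_gen hQ hQn hlim hker f (eps / 2)) as [N hN].
  { pose proof (cond_pos eps). lra. }
  exists N. intros n hn. destruct (hlub n) as [m [hub hleast]]. simpl.
  rewrite Rminus_0_r.
  assert (0 <= m).
  { apply Rle_trans with (norm (minus (Sn n T f) (S T f))); [apply hnorm_ge_0|].
    apply hub. exists T. split; [lra|reflexivity]. }
  rewrite Rabs_right by lra. pose proof (cond_pos eps).
  (* A supremum of values below [eps / 2] is only known to be at most [eps / 2]; the halving
     restores strictness. *)
  apply Rle_lt_trans with (eps / 2); [|lra].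
  apply hleast. intros r (t & ht & ->). left. apply hN; assumption.
Qed.
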